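(* For every integer $k>0$ there are graphs $G$ such that every distributed algorithm for the weighted 2-spanner problem that runs in $k$ communication rounds in the LOCAL model has, on $G$, approximation ratio at least $\Omega\!\left(\frac{n^{\frac{1-o(1)}{4k^2}}}{k}\right)$ and at least $\Omega\!\left(\frac{\Delta^{\frac{1}{k+1}}}{k}\right)$, where $n$ is the number of vertices and $\Delta$ the maximum degree.
   Context: Weighted 2-spanner problem: the input is a connected undirected graph $G=(V,E)$ with non-negative edge weights $w(e)$ (all edges have length 1). A subgraph $H\subseteq E$ is a 2-spanner if for every edge $\{u,v\}\in E$ there is a path with at most 2 edges between $u$ and $v$ in $H$; the goal is to minimize $w(H)=\sum_{e\in H}w(e)$. Distributed setting: the input graph is the communication network; vertices have unique IDs and initially know their incident edges and weights; synchronous rounds; each vertex outputs a subset of its incident edges. In the LOCAL model messages have unbounded size. *)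

(* Defs.v *)
From HB Require Import structures.
From mathcomp Require Import all_boot all_order all_algebra.
Set Implicit Arguments.
Unset Strict Implicit.
Unset Printing Implicit Defensive.
Import Order.TTheory GRing.Theory Num.Theory.
Local Open Scope ring_scope.

Definition adjacent (V : finType) (E : {set {set V}}) : rel V :=
  fun u v => [set u; v] \in E.

(* Edges are two-element vertex sets, so graphs are simple and undirected. *)
Record wgraph (R : realFieldType) := WGraph {
  vertex : finType;
  edges : {set {set vertex}};
  weight : {set vertex} -> R;
  edges_card2 : forall e, e \in edges -> #|e| = 2%N;
  edges_connected : forall u v : vertex, connect (adjacent edges) u v;
  weight_ge0 : forall e, e \in edges -> 0 <= weight e }.

Definition nvert (R : realFieldType) (G : wgraph R) : nat := #|vertex G|.

Definition max_degree (R : realFieldType) (G : wgraph R) : nat :=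
  (\max_(v : vertex G) #|[set e in edges G | v \in e]|)%N.

Definition cost (R : realFieldType) (G : wgraph R) (H : {set {set vertex G}}) : R :=
  \sum_(e in H) weight e.

Definition is_2spanner (R : realFieldType) (G : wgraph R)
    (H : {set {set vertex G}}) : bool :=
  (H \subset edges G) &&
  [forall u, forall v, adjacent (edges G) u v ==>
     [exists p : 2.-bseq (vertex G), path (adjacent H) u p && (last u p == v)]].

(* [edges G] is itself a 2-spanner, so it can serve as the default of the
   minimum. *)
Definition opt_cost (R : realFieldType) (G : wgraph R) : R :=
  \big[Num.min/cost (edges G)]_(H : {set {set vertex G}} | is_2spanner H) cost H.

(* A synchronous message-passing algorithm for n-vertex networks with
   identifiers in 'I_n. States and messages are arbitrary (unbounded message
   size, unbounded local computation). Vertices draw private independent seeds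
   from [seed_dist]; a deterministic algorithm has a one-point seed type.
   A vertex refers to an incident edge by the identifier of its other end. *)
Record local_algorithm (R : realFieldType) (n : nat) := LocalAlgorithm {
  state : Type;
  message : Type;
  seed : finType;
  seed_dist : seed -> R;
  seed_dist_ge0 : forall s, 0 <= seed_dist s;
  seed_dist_sum1 : \sum_s seed_dist s = 1;
  (* own identifier, own seed, and the weight of the edge to each neighbour
     ([None] at identifiers that are not those of neighbours) *)
  init : 'I_n -> seed -> ('I_n -> option R) -> state;
  (* message to the neighbour with the given identifier *)
  send : state -> 'I_n -> message;
  (* messages received in this round, by identifier of the sender *)
  receive : state -> ('I_n -> option message) -> state;
  output : state -> pred 'I_n }.

Section Execution.
Variables (R : realFieldType) (n : nat) (A : local_algorithm R n).
Variables (G : wgraph R) (id : {ffun vertex G -> 'I_n}).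

Definition neighbour (v : vertex G) (i : 'I_n) : option (vertex G) :=
  [pick u | adjacent (edges G) v u && (id u == i)].

Fixpoint state_after (tape : {ffun vertex G -> seed A}) (t : nat) (v : vertex G) : state A :=
  if t is t'.+1 then
    receive (state_after tape t' v)
      (fun i => omap (fun u => send (state_after tape t' u) (id v)) (neighbour v i))
  else
    init (id v) (tape v) (fun i => omap (fun u => weight [set v; u]) (neighbour v i)).

Definition vertex_output (tape : {ffun vertex G -> seed A}) (k : nat) (v : vertex G) :
    {set {set vertex G}} :=
  [set [set v; u] | u in [pred u | adjacent (edges G) v u &&
                                   output (state_after tape k v) (id u)]].

Definition run (k : nat) (tape : {ffun vertex G -> seed A}) : {set {set vertex G}} :=
  \bigcup_v vertex_output tape k v.

Definition tape_prob (tape : {ffun vertex G -> seed A}) : R :=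
  \prod_v seed_dist (tape v).

Definition expected_cost (k : nat) : R :=
  \sum_(tape : {ffun vertex G -> seed A}) tape_prob tape * cost (run k tape).

End Execution.

(* Correct on every n-vertex input, for every assignment of unique identifiers,
   with probability 1. *)
Definition solves_2spanner (R : realFieldType) (n : nat) (A : local_algorithm R n)
    (k : nat) : Prop :=
  forall (G : wgraph R) (id : {ffun vertex G -> 'I_n}),
    nvert G = n -> injective id ->
    forall tape : {ffun vertex G -> seed A},
      0 < tape_prob tape -> is_2spanner (run id k tape).

(* Worst case over identifier assignments: the graph is fixed before the
   algorithm, its identifiers after. If [opt_cost G = 0] the value is 0, so a
   positive lower bound on it entails [0 < opt_cost G]. *)
Definition approx_ratio (R : realFieldType) (n : nat) (A : local_algorithm R n)
    (k : nat) (G : wgraph R) : R :=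
  \big[Num.max/0]_(id : {ffun vertex G -> 'I_n} | injectiveb id)
    (expected_cost A id k / opt_cost G).

(* Main.v *)
(* A 2-spanner must pay for one endpoint of every edge of a vertex covering
   instance, once each vertex v is replaced by two copies joined by an edge of
   weight w(v), and each edge by two free edges between equal copies and two edges
   of weight 1 between opposite copies. So a lower bound for weighted vertex
   cover suffices.

   The covering instance is of Kuhn-Moscibroda-Wattenhofer type: a tree of
   clusters in which a vertex of the root cluster has one neighbour in group 0 and
   d^i - d^(i-1) neighbours in group i, 0 < i <= k, while a vertex of group i < k
   has d^(i+1) parents. So the clusters get smaller by a factor d at each step, and
   the non-root ones form a cheap cover. The vertices of group k get weight 0, which
   saves one power of d in the degree.

   A vertex of group 0 looks like a root vertex only to depth k-1. But a root
   vertex cannot distinguish the instance G from another instance G' on the same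
   vertices, in which the root cluster is matched with itself instead of with
   group 0. In G' two adjacent root vertices look alike, so one of them pays with
   probability at least 1/2, and hence so does every root vertex of G.

   Views have to be trees for this. Both graphs are lifts of the cluster graph
   along a group of unipotent matrices over F_p in which short alternating
   products of elements of two one-parameter subgroups are never trivial. *)

Require Import Defs.
From HB Require Import structures.
From mathcomp Require Import all_boot all_order all_algebra all_fingroup.
From mathcomp Require Import zify ring lra.
From mathcomp Require boolp.
Set Implicit Arguments.
Unset Strict Implicit.
Unset Printing Implicit Defensive.
Import Order.TTheory GRing.Theory Num.Theory.

(** * Alternating products of elementary matrices *)

Section AlternatingWords.
Local Open Scope ring_scope.
Variables (F : finFieldType) (D : nat).
Implicit Types (t : bool) (x y : F) (w : seq F).

(** [shift_mx true] is the superdiagonal cut down to the even rows, [shift_mx false] to the odd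
    ones. Neither has two consecutive steps, so both square to zero and each [letter t] is a
    one-parameter subgroup. *)
Definition shift_mx t : 'M[F]_D.+1 :=
  \matrix_(i, j) ((odd i == ~~ t) && (j == i.+1 :> nat))%:R.

Definition letter t x : 'M[F]_D.+1 := 1 + x *: shift_mx t.

Fixpoint alt_mx t w : 'M[F]_D.+1 :=
  if w is x :: w' then letter t x * alt_mx (~~ t) w' else 1.

Lemma mulmx_shift t (A : 'M[F]_D.+1) i j :
  (shift_mx t * A) i j =
  if (odd i == ~~ t) && (i < D)%N then A (inord i.+1) j else 0.
Proof.
rewrite mxE; case: ifP => [/andP[par lt_iD]|].
  rewrite (bigD1 (inord i.+1)) //= mxE par inordK // eqxx mul1r.
  rewrite big1 ?addr0 // => l neq; rewrite mxE par /=.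
  case: eqP => [el|_]; last by rewrite mul0r.
  by case/eqP: neq; apply: val_inj; rewrite /= inordK.
move=> no; rewrite big1 // => l _; rewrite mxE.
case: andP => [[par /eqP el]|]; last by rewrite mul0r.
by move: no; rewrite par /= -ltnS -el ltn_ord.
Qed.

Lemma shift_mx_sqr t : shift_mx t * shift_mx t = 0.
Proof.
apply/matrixP => i j; rewrite mulmx_shift !mxE; case: ifP => // /andP[/eqP par lt_iD].
by rewrite inordK // [odd _]/= par; case: t {par}.
Qed.

Lemma letterD t x y : letter t (x + y) = letter t x * letter t y.
Proof.
rewrite /letter mulrDl mul1r mulrDr mulr1 -scalerAl -scalerAr shift_mx_sqr.
by rewrite !scaler0 addr0 scalerDl addrA addrAC.
Qed.

Lemma letter0 t : letter t 0 = 1.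
Proof. by rewrite /letter scale0r addr0. Qed.

Lemma letterK t x : letter t x * letter t (- x) = 1.
Proof. by rewrite -letterD subrr letter0. Qed.

Lemma letter_unit t x : letter t x \is a GRing.unit.
Proof.
by apply/unitrP; exists (letter t (- x)); rewrite letterK -{2}(opprK x) letterK.
Qed.

Lemma letter_mulE t x (A : 'M[F]_D.+1) i j :
  (letter t x * A) i j =
  A i j + if (odd i == ~~ t) && (i < D)%N then x * A (inord i.+1) j else 0.
Proof.
rewrite /letter mulrDl mul1r -scalerAl mxE [X in _ + X]mxE mulmx_shift.
by case: ifP; rewrite ?mulr0.
Qed.

Definition entry (A : 'M[F]_D.+1) i j := A (inord i) (inord j).

Lemma entry_letter t x A i j : (i <= D)%N ->
  entry (letter t x * A) i j =
  entry A i j + if (odd i == ~~ t) && (i < D)%N then x * entry A i.+1 j else 0.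
Proof. by move=> le_iD; rewrite /entry letter_mulE inordK. Qed.

Lemma entry1 i j : (i <= D)%N -> (j <= D)%N -> entry 1 i j = (i == j)%:R.
Proof.
move=> le_i le_j; rewrite /entry mxE; congr (_%:R); congr nat_of_bool.
apply/eqP/eqP => [/(congr1 val)|-> //]; by rewrite /= !inordK.
Qed.

Lemma entry_alt_far t w i j : (i + size w < j)%N -> (j <= D)%N ->
  entry (alt_mx t w) i j = 0.
Proof.
elim: w t i => [|x w IH] t i /=; first by move=> ? ?; rewrite entry1 ?ltn_eqF //; lia.
move=> lt_j le_j; rewrite entry_letter ?IH ?add0r //; try lia.
by rewrite mulr0 if_same.
Qed.

(** The first letter does not act on row [i], so one letter fewer can advance the column. *)
Lemma entry_alt_near t w i j : odd i = t -> (i < j)%N -> (i + size w <= j)%N ->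
  (j <= D)%N -> entry (alt_mx t w) i j = 0.
Proof.
case: w => [|x w] /=; first by move=> *; rewrite entry1 ?ltn_eqF //; lia.
move=> par lt_ij le_j le_jD; rewrite entry_letter; last lia.
by rewrite entry_alt_far ?add0r ?par; try lia; case: t {par}.
Qed.

(** Row [i] has the parity on which the first letter acts. Column [i + size w] is reached only if
    every letter advances by one, so a single product contributes. *)
Lemma entry_alt_top t w i : odd i = ~~ t -> (i + size w <= D)%N ->
  entry (alt_mx t w) i (i + size w) = \prod_(x <- w) x.
Proof.
elim: w t i => [|x w IH] t i par /=; first by move=> ?; rewrite big_nil entry1 ?addn0 ?eqxx //; lia.
move=> le_D; rewrite entry_letter; last lia.
rewrite (entry_alt_near par) ?add0r; try lia.
rewrite par eqxx big_cons -addSnnS IH /= ?par //; last lia.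
by rewrite ifT //; lia.
Qed.

Lemma alt_mx_rcons t w x :
  alt_mx t (rcons w x) = alt_mx t w * letter (t (+) odd (size w)) x.
Proof.
elim: w t => [|y w IH] t /=; first by rewrite addbF mul1r mulr1.
by rewrite IH mulrA addNb addbN.
Qed.

Lemma prod_nonzero w : all (fun x => x != 0) w -> \prod_(x <- w) x != 0.
Proof.
elim: w => [|x w IH] /=; first by rewrite big_nil oner_eq0.
by case/andP=> x0 /IH w0; rewrite big_cons mulf_neq0.
Qed.

(* A word of full length [D] starting with an odd letter is too long to be
   read off row 1, so its last letter is moved to the other side first. *)
Lemma alt_mx_free w1 w2 :
  all (fun x => x != 0) w1 -> all (fun x => x != 0) w2 ->
  (size w1 <= D)%N -> (size w2 <= D)%N -> (0 < size w1 + size w2)%N -> (1 < D)%N ->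
  alt_mx true w1 <> alt_mx false w2.
Proof.
move=> nz1 nz2 le1 le2 gt0 gt1 eq12.
have [le21|lt12] := leqP (size w2) (size w1).
  have top := @entry_alt_top true w1 0 erefl le1.
  move: (prod_nonzero nz1); rewrite -top eq12 entry_alt_near ?eqxx //; lia.
have [lt2|] := ltnP (size w2) D.
  have top := @entry_alt_top false w2 1 erefl lt2.
  move: (prod_nonzero nz2); rewrite -top -eq12 entry_alt_near ?eqxx //; lia.
move=> ge2; have {le2 ge2} sz2 : size w2 = D by lia.
case/lastP: w2 => [|w2 x] in nz2 lt12 gt0 eq12 sz2 *; first by move: sz2 gt1 => /= <-.
rewrite size_rcons in lt12 sz2; move: nz2; rewrite all_rcons => /andP[x0 nz2].
have eqw : alt_mx true w1 * letter (odd (size w2)) (- x) = alt_mx false w2.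
  by rewrite eq12 alt_mx_rcons -mulrA addFb letterK mulr1.
have top := @entry_alt_top false w2 1 erefl.
have {}top := top _; rewrite add1n sz2 leqnn in top; have {}top := top isT.
move: (prod_nonzero nz2); rewrite -{}top -{}eqw => /eqP; apply.
have [w' le' ->] : exists2 w', (size w' <= size w2)%N &
    alt_mx true w1 * letter (odd (size w2)) (- x) = alt_mx true w'.
  have [eqpar|neqpar] := eqVneq (odd (size w1)) (odd (size w2)); last first.
    exists (rcons w1 (- x)); last by rewrite alt_mx_rcons; case: odd neqpar; case: odd.
    by rewrite size_rcons; move: neqpar; rewrite ltnS leq_eqVlt in lt12; case/orP: lt12 => [/eqP-> /eqP|].
  case/lastP: w1 => [|w y] in eqpar lt12 {nz1 le1 gt0 eq12} *.
    (* The zero letter gives the next one the right type. There is room for it, since [size w2] is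
       even and positive here. *)
    exists [:: 0; - x]; last by rewrite /= letter0 !mul1r mulr1 -eqpar.
    by move: eqpar sz2 gt1; rewrite /=; case: (size w2) => [|[|?]] //= *; lia.
  exists (rcons w (y - x)); first by move: lt12; rewrite !size_rcons.
  rewrite !alt_mx_rcons letterD mulrA -eqpar size_rcons /=.
  by case: odd.
by apply: entry_alt_near => //; lia.
Qed.

(** The square of the full shift [shift_mx true + shift_mx false], of which only the mixed terms
    survive. *)
Definition twoshift_mx : 'M[F]_D.+1 :=
  shift_mx true * shift_mx false + shift_mx false * shift_mx true.

Lemma twoshift_comm t x : letter t x * twoshift_mx = twoshift_mx * letter t x.
Proof.
rewrite /letter [LHS]mulrDl [RHS]mulrDr mul1r mulr1 -scalerAl -scalerAr.
congr (_ + _ *: _); rewrite /twoshift_mx mulrDr mulrDl; case: t.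
  by rewrite !mulrA shift_mx_sqr mul0r -!mulrA shift_mx_sqr !mulr0 addrC.
by rewrite !mulrA shift_mx_sqr mul0r -!mulrA shift_mx_sqr !mulr0 addrC.
Qed.

Lemma mulmx_twoshift (A : 'M[F]_D.+1) (i j : 'I_D.+1) : (i.+1 < D)%N ->
  (twoshift_mx * A) i j = A (inord i.+2) j.
Proof.
move=> lt_i; rewrite /twoshift_mx mulrDl mxE -!mulrA !mulmx_shift !inordK ?ltnS; try lia.
by rewrite lt_i (ltnW lt_i) /= !andbT; case: odd; rewrite ?addr0 ?add0r.
Qed.

(** Commuting with the double shift makes entries repeat along diagonals with period two. The full
    unipotent group has order [#|F|] to a power quadratic in [D]; here the power is linear, which
    keeps the number of vertices at [d] to a power quadratic in [k]. *)
Definition toeplitz (A : 'M[F]_D.+1) :=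
  [&& A * twoshift_mx == twoshift_mx * A,
      [forall i, A i 0 == (i == 0)%:R] &
      [forall i : 'I_D.+1, (0 < i)%N ==> (A i (inord 1) == (i == 1 :> nat)%:R)]].

Lemma toeplitz1 : (0 < D)%N -> toeplitz 1.
Proof.
move=> D0; apply/and3P; split; first by rewrite mul1r mulr1.
  by apply/forallP => i; rewrite mxE.
apply/forallP => i; apply/implyP => _; rewrite mxE; apply/eqP; congr (_%:R).
by rewrite -val_eqE /= inordK.
Qed.

Lemma toeplitzM A B : (0 < D)%N -> toeplitz A -> toeplitz B -> toeplitz (A * B).
Proof.
move=> D0 /and3P[/eqP cA /forallP zA /forallP oA] /and3P[/eqP cB /forallP zB /forallP oB].
apply/and3P; split; first by rewrite -mulrA cB mulrA cA mulrA.
  apply/forallP => i; rewrite mxE (bigD1 0) //= (eqP (zB _)) eqxx mulr1 big1 ?addr0 //.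
  by move=> l /negbTE l0; rewrite (eqP (zB l)) l0 mulr0.
apply/forallP => i; apply/implyP => i0; rewrite mxE (bigD1 0) //= (bigD1 (inord 1)) /=; last first.
  by rewrite -val_eqE /= inordK.
have -> : A i 0 = 0 by rewrite (eqP (zA i)) -val_eqE /= eqn0Ngt i0.
rewrite mul0r add0r (eqP (implyP (oB (inord 1)) _)) inordK // eqxx mulr1.
rewrite big1 ?addr0; first exact: (implyP (oA i)).
move=> l /andP[l0 l1]; have gt0 : (0 < l)%N by rewrite lt0n -val_eqE in l0 *.
rewrite (eqP (implyP (oB l) gt0)); have /negbTE-> : l != 1 :> nat; last by rewrite mulr0.
by apply: contra l1 => /eqP l1; rewrite -val_eqE /= inordK // l1.
Qed.

Lemma toeplitz_letter t x : (0 < D)%N -> toeplitz (letter t x).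
Proof.
move=> D0; apply/and3P; split; first by rewrite twoshift_comm.
  by apply/forallP => i; rewrite !mxE andbF mulr0 addr0.
apply/forallP => i; apply/implyP => i0; rewrite !mxE inordK // eqSS.
rewrite (ltn_eqF i0) andbF mulr0 addr0; apply/eqP; congr (_%:R).
by rewrite -val_eqE /= inordK.
Qed.

(** Row [n.+2] of [A] is row [n] of [twoshift_mx * A = A * twoshift_mx], which involves row [n] of
    [A] only; so rows 0 and 1 determine the rest. *)
Lemma toeplitz_inj A B : (0 < D)%N -> toeplitz A -> toeplitz B ->
  (forall j, A 0 j = B 0 j) -> (forall j, A (inord 1) j = B (inord 1) j) -> A = B.
Proof.
move=> D0 /and3P[/eqP cA _ _] /and3P[/eqP cB _ _] e0 e1.
suff eqr n : (n <= D)%N -> forall j, A (inord n) j = B (inord n) j.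
  by apply/matrixP => i j; rewrite -(inord_val i); apply: eqr; rewrite -ltnS.
have [m] := ubnP n; elim: m n => // m IH [|[|n]] lt_m le_n j //.
  by rewrite (_ : inord 0 = 0) //; apply: val_inj; rewrite /= inordK.
have lt_n : ((inord n : 'I_D.+1).+1 < D)%N by rewrite inordK; lia.
have stepE C : (twoshift_mx * C) (inord n) j = C (inord n.+2) j.
  by rewrite mulmx_twoshift // inordK //; lia.
rewrite -(stepE A) -(stepE B) -cA -cB !mxE; apply: eq_bigr => l _.
by rewrite IH //; lia.
Qed.

End AlternatingWords.

Fixpoint alt_word (F : Type) (gT : finGroupType) (L : bool -> F -> gT) t w : gT :=
  (if w is x :: w' then L t x * alt_word L (~~ t) w' else 1)%g.

(** In the free product of two copies of [F] the second clause holds for words of every length; here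
    it is asked up to length [D]. *)
Definition alternating_free (F : finFieldType) D (gT : finGroupType)
    (L : bool -> F -> gT) : Prop :=
  [/\ forall t x y, L t (x + y)%R = (L t x * L t y)%g &
      forall w1 w2, all (fun x => x != 0)%R w1 -> all (fun x => x != 0)%R w2 ->
        size w1 <= D -> size w2 <= D -> 0 < size w1 + size w2 ->
        alt_word L true w1 <> alt_word L false w2].

(** * A small finite group without short alternating relations *)

Section ToeplitzGroup.
Variables (F : finFieldType) (D : nat).
Hypothesis D1 : 1 < D.
Let uT := {unit 'M[F]_D.+1}%type.

Let D0 : 0 < D. Proof. exact: ltnW. Qed.

Definition toeplitz_set := [set u : uT | toeplitz (val u)].

Lemma toeplitz_group_set : group_set toeplitz_set.
Proof.
apply/group_setP; split; first by rewrite inE toeplitz1.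
by move=> u v; rewrite !inE => tu tv; rewrite FinRing.val_unitM toeplitzM.
Qed.

Definition toeplitz_group := Group toeplitz_group_set.

Definition unit_letter t (x : F) : uT := FinRing.unit _ (letter_unit D t x).

Definition toeplitz_letter_of t (x : F) : subg_of toeplitz_group :=
  subg toeplitz_group (unit_letter t x).

Lemma val_toeplitz_letter t x : val (sgval (toeplitz_letter_of t x)) = letter D t x.
Proof. by rewrite subgK // inE toeplitz_letter. Qed.

(** The free entries are those of row 0 beyond column 0 and of row 1 beyond column 1. *)
Lemma card_toeplitz : #|{: subg_of toeplitz_group}| <= #|F| ^ (D + D.-1).
Proof.
pose f (u : subg_of toeplitz_group) : {ffun 'I_D -> F} * {ffun 'I_D.-1 -> F} :=
  let A : 'M[F]_D.+1 := val (sgval u) in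
  ([ffun i : 'I_D => A ord0 (inord i.+1)], [ffun i : 'I_D.-1 => A (inord 1) (inord i.+2)]).
have finj : injective f.
  move=> u v [/ffunP e0 /ffunP e1]; apply: val_inj; apply: val_inj.
  have := subgP v; have := subgP u; rewrite !inE => tu tv.
  have [/and3P[_ /forallP zu /forallP ou] /and3P[_ /forallP zv /forallP ov]] := (tu, tv).
  apply: toeplitz_inj => // j.
    have [->|j0] := eqVneq j 0%R; first by rewrite (eqP (zu _)) (eqP (zv _)).
    have lt : j.-1 < D by have := ltn_ord j; move: j0; rewrite -val_eqE /=; lia.
    have := e0 (Ordinal lt); rewrite !ffunE /= prednK ?inord_val //.
    by rewrite lt0n -val_eqE in j0 *.
  have [->|j0] := eqVneq j 0%R; first by rewrite (eqP (zu _)) (eqP (zv _)).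
  have one0 : 0 < (inord 1 : 'I_D.+1) by rewrite inordK.
  have [->|j1] := eqVneq j (inord 1).
    by rewrite (eqP (implyP (ou _) one0)) (eqP (implyP (ov _) one0)).
  have lt : j.-2 < D.-1.
    have := ltn_ord j; move: j0 j1 D1; rewrite -!val_eqE /= inordK //; lia.
  have := e1 (Ordinal lt); rewrite !ffunE /=.
  suff -> : j.-2.+2 = j by rewrite inord_val.
  by move: j0 j1; rewrite -!val_eqE /= inordK //; lia.
rewrite -(card_codom finj) (leq_trans (max_card _)) //.
by rewrite card_prod !card_ffun !card_ord expnD.
Qed.

Lemma val_toeplitzM (u v : subg_of toeplitz_group) :
  val (sgval (u * v)%g) = (val (sgval u) * val (sgval v))%R.
Proof. by []. Qed.

Lemma val_alt_word t w :
  val (sgval (alt_word toeplitz_letter_of t w)) = alt_mx D t w.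
Proof.
elim: w t => [|x w IH] t //; rewrite [RHS]/=.
by rewrite -IH -val_toeplitz_letter.
Qed.

Lemma toeplitz_alternating_free : alternating_free D toeplitz_letter_of.
Proof.
split=> [t x y|w1 w2 nz1 nz2 le1 le2 gt0 eq12].
  apply: val_inj; apply: val_inj; rewrite [RHS]val_toeplitzM.
  by rewrite !val_toeplitz_letter letterD.
apply: (@alt_mx_free F D w1 w2) => //.
by rewrite -!val_alt_word eq12.
Qed.

End ToeplitzGroup.

(** * Local isomorphism of port-numbered graphs *)

(** Turns an isomorphism of balls into a permutation of all vertices, along which identifiers and
    seeds can be transported. [A] followed by its complement is matched by position with the image
    followed by its complement. *)
Lemma extend_to_perm (T : finType) (A : {set T}) (f : T -> T) :
  {in A &, injective f} -> exists phi : {perm T}, {in A, phi =1 f}.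
Proof.
move=> finj; pose s1 := enum A ++ enum (~: A).
pose s2 := map f (enum A) ++ enum (~: (f @: A)).
have sz1 : size s1 = #|T| by rewrite size_cat -!cardE cardsC.
have sz2 : size s2 = #|T|.
  by rewrite size_cat size_map -!cardE -(card_in_imset finj) cardsC.
have u2 : uniq s2.
  rewrite cat_uniq map_inj_in_uniq ?enum_uniq ?andbT /=; last first.
    by move=> x y; rewrite !mem_enum; apply: finj.
  apply/hasPn => x; rewrite mem_enum inE => nx; apply: contra nx.
  by case/mapP => y; rewrite mem_enum => Ay ->; apply: imset_f.
have m1 x : x \in s1 by rewrite mem_cat !mem_enum inE orbN.
pose g x := nth x s2 (index x s1).
have lt x : index x s1 < size s2 by rewrite sz2 -sz1 index_mem.
have ginj : injective g.
  move=> x y; rewrite /g (set_nth_default y) // => /eqP.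
  rewrite nth_uniq // => /eqP eqi.
  by rewrite -(nth_index x (m1 x)) eqi nth_index.
exists (perm ginj) => x Ax; rewrite permE /g /s1 index_cat mem_enum Ax.
have ltx : index x (enum A) < size (enum A) by rewrite index_mem mem_enum.
by rewrite nth_cat size_map ltx (nth_map x) // nth_index // mem_enum.
Qed.

Section PortWalks.
Variables (V P : finType).
Implicit Types (nb : V -> P -> option (V * P)) (st : V * option P) (w : seq P).

(** [nb v s = Some (v', s')] stands for an edge that joins port [s] of [v] to port [s'] of [v']. *)
Definition involutive_ports nb :=
  forall v s v' s', nb v s = Some (v', s') -> nb v' s' = Some (v, s).

Definition port_adj nb v x := [exists s, omap fst (nb v s) == Some x].

Lemma port_adjP nb v x :
  reflect (exists s s', nb v s = Some (x, s')) (port_adj nb v x).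
Proof.
apply: (iffP existsP) => [[s]|[s [s' e]]]; last by exists s; rewrite e.
by case e: (nb v s) => [[x' s']|] //= /eqP[<-]; exists s, s'.
Qed.

Lemma port_adj_sym nb : involutive_ports nb -> symmetric (port_adj nb).
Proof.
move=> inv v x; apply/port_adjP/port_adjP => -[s [s' e]];
by exists s', s; apply: inv.
Qed.

(* The optional port in a state is the one through which the walk arrived;
   a walk never leaves through it, so all walks below are non-backtracking. *)
Definition walk_step nb (ost : option (V * option P)) s :=
  if ost is Some (v, a) then
    if a == Some s then None
    else if nb v s is Some (v', s') then Some (v', Some s') else None
  else None.

Definition walk nb st w := foldl (walk_step nb) (Some st) w.

(** The unfolding of the graph at [u] to depth [n] is injective: the form in which large girth is
    needed. *)
Definition unique_ends nb u n := forall w1 w2 v a1 a2,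
  walk nb (u, None) w1 = Some (v, a1) -> walk nb (u, None) w2 = Some (v, a2) ->
  size w1 <= n -> size w2 <= n -> w1 = w2.

Definition walk_ball nb u n v :=
  exists w a, size w <= n /\ walk nb (u, None) w = Some (v, a).

Lemma walk_rcons nb st w s : walk nb st (rcons w s) = walk_step nb (walk nb st w) s.
Proof. by rewrite /walk foldl_rcons. Qed.

Lemma walk_arrival nb u w v b : involutive_ports nb ->
  walk nb (u, None) w = Some (v, Some b) ->
  exists w' s x a, [/\ w = rcons w' s, walk nb (u, None) w' = Some (x, a),
                       a != Some s & nb v b = Some (x, s)].
Proof.
move=> inv; case/lastP: w => [//|w s]; rewrite walk_rcons /walk_step.
case e: (walk _ _ _) => [[x a]|] //; case: eqP => // /eqP na.
case es: (nb x s) => [[v' s']|] //= [<- <-].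
by exists w, s, x, a; split=> //; apply: inv.
Qed.

Lemma walk1 nb u s :
  walk nb (u, None) [:: s] = omap (fun x => (x.1, Some x.2)) (nb u s).
Proof. by rewrite /walk /=; case: (nb u s) => [[]|]. Qed.

Lemma walk_ball0 nb u : walk_ball nb u 0 u.
Proof. by exists [::], None. Qed.

Lemma walk_ballW nb u m n v : m <= n -> walk_ball nb u m v -> walk_ball nb u n v.
Proof. by move=> le_mn [w [a [le_w ?]]]; exists w, a; split=> //; apply: leq_trans le_mn. Qed.

(** A step through the arrival port undoes the last step and leaves a shorter walk; any other step
    extends the walk. *)
Lemma walk_ball_step nb u n v x : involutive_ports nb ->
  walk_ball nb u n v -> port_adj nb v x -> walk_ball nb u n.+1 x.
Proof.
move=> inv [w [a [le_w ew]]] /port_adjP[s [s' es]].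
have [ea|na] := eqVneq a (Some s); last first.
  exists (rcons w s), (Some s'); rewrite size_rcons ltnS walk_rcons ew /=.
  by rewrite (negbTE na) es.
rewrite ea in ew; have [w' [s0 [x0 [a0 [ew' ewalk _ e0]]]]] := walk_arrival inv ew.
move: e0; rewrite es => -[-> _]; exists w', a0; split=> //.
by move: le_w; rewrite ew' size_rcons; lia.
Qed.

End PortWalks.

Section Coupling.
Variables (V P : finType).

(* Two walks in graphs that look alike are coupled by leaving through the same
   port, except that the two arrival ports are exchanged. *)
Definition swap_ports (a1 a2 : option P) (s : P) : P :=
  if a1 is Some b1 then if a2 is Some b2 then tperm b1 b2 s else s else s.

Lemma swap_portsK a1 a2 s : swap_ports a2 a1 (swap_ports a1 a2 s) = s.
Proof. by case: a1 a2 => [b1|] [b2|] //=; rewrite tpermC tpermK. Qed.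

Definition pair_step (nb1 nb2 : V -> P -> option (V * P))
    (o : option (seq P * (V * option P) * (V * option P))) s :=
  if o is Some (w2, (v1, a1), (v2, a2)) then
    if a1 == Some s then None
    else if nb1 v1 s is Some (x1, b1) then
      if nb2 v2 (swap_ports a1 a2 s) is Some (x2, b2) then
        Some (rcons w2 (swap_ports a1 a2 s), (x1, Some b1), (x2, Some b2))
      else None
    else None
  else None.

Definition pair_walk nb1 nb2 u1 u2 w :=
  foldl (pair_step nb1 nb2) (Some ([::], (u1, None), (u2, None))) w.

Lemma pair_walk_rcons nb1 nb2 u1 u2 w s :
  pair_walk nb1 nb2 u1 u2 (rcons w s) =
  pair_step nb1 nb2 (pair_walk nb1 nb2 u1 u2 w) s.
Proof. by rewrite /pair_walk foldl_rcons. Qed.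

Variables (C : Type) (col : nat -> V -> C) (G : nat -> C -> P -> option C).
Variables (T : nat -> C -> C) (k : nat).
Hypothesis colT : forall j v, col j v = T j (col j.+1 v).

(** [col j v] is what shows of [v] when [j] further steps can be seen. It determines the colours of
    the neighbours one level lower, port by port, by a rule [G] that is to be common to both
    graphs. *)
Definition colored (nb : V -> P -> option (V * P)) (Q : pred V) :=
  (forall v s v' s', Q v -> nb v s = Some (v', s') -> Q v') /\
  (forall j v s, j <= k -> Q v ->
     omap (fun x => col j x.1) (nb v s) = G j (col j.+1 v) s).

Definition same_upto j v1 v2 := forall i, i <= j -> col i v1 = col i v2.

Lemma same_uptoP j v1 v2 : col j v1 = col j v2 -> same_upto j v1 v2.
Proof.
move=> e i; elim: j e => [|j IH] e; first by rewrite leqn0 => /eqP->.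
by rewrite leq_eqVlt ltnS => /orP[/eqP-> //|]; apply: IH; rewrite colT e -colT.
Qed.

Section TwoGraphs.
Variables (nb1 nb2 : V -> P -> option (V * P)) (Q1 Q2 : pred V) (u1 u2 : V).
Hypotheses (inv1 : involutive_ports nb1) (inv2 : involutive_ports nb2).
Hypotheses (col1 : colored nb1 Q1) (col2 : colored nb2 Q2).
Hypotheses (Qu1 : Q1 u1) (Qu2 : Q2 u2) (colu : col k.+1 u1 = col k.+1 u2).

Definition coupled j v1 (a1 : option P) v2 (a2 : option P) : Prop :=
  [/\ Q1 v1, Q2 v2, same_upto j v1 v2 &
   match a1, a2 with
   | None, None => True
   | Some b1, Some b2 => exists p1 s1 p2 s2,
       [/\ nb1 v1 b1 = Some (p1, s1), nb2 v2 b2 = Some (p2, s2) & same_upto j p1 p2]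
   | _, _ => False
   end].

(** The rule gives both vertices the same neighbour colours at equal ports. The two predecessors
    share a colour as well, so [b1] and [b2] lead to equal colours and may be exchanged. *)
Lemma coupled_ports j v1 a1 v2 a2 s : j <= k -> coupled j.+1 v1 a1 v2 a2 ->
  omap (fun x => col j x.1) (nb1 v1 s) =
  omap (fun x => col j x.1) (nb2 v2 (swap_ports a1 a2 s)).
Proof.
move=> le_jk [q1 q2 same par]; rewrite (proj2 col1) // (proj2 col2) // same //.
case: a1 a2 par => [b1|] [b2|] //= [p1 [s1 [p2 [s2 [e1 e2 samep]]]]].
have eqb : G j (col j.+1 v2) b1 = G j (col j.+1 v2) b2.
  rewrite -{1}same // -(proj2 col1) // -(proj2 col2) // e1 e2 /=.
  by rewrite samep.
by case: tpermP => [->|->|].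
Qed.

(** Each step lowers the level of agreement by one. Coupling with the two graphs exchanged leads
    back to [w], which later makes the map between end points injective. *)
Lemma pair_walkP w v1 a1 : walk nb1 (u1, None) w = Some (v1, a1) -> size w <= k.+1 ->
  exists w2 v2 a2,
  [/\ pair_walk nb1 nb2 u1 u2 w = Some (w2, (v1, a1), (v2, a2)),
      pair_walk nb2 nb1 u2 u1 w2 = Some (w, (v2, a2), (v1, a1)),
      walk nb2 (u2, None) w2 = Some (v2, a2), size w2 = size w &
      coupled (k.+1 - size w) v1 a1 v2 a2].
Proof.
elim/last_ind: w v1 a1 => [|w s IH] v1 a1.
  move=> [<- <-] _; exists [::], u2, None; split=> //; split=> //.
  by rewrite subn0; apply: same_uptoP.
rewrite walk_rcons /walk_step size_rcons => ew le_w.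
case e0: (walk _ _ _) ew => [[x1 c1]|] //; case: eqP => // /eqP nc.
case es: (nb1 x1 s) => [[v1' b1]|] // [<- <-].
have [w2 [x2 [c2 [p12 p21 ew2 sz2 cp]]]] := IH _ _ e0 (ltnW le_w).
rewrite subSn // in cp; set j := k - size w in cp.
have le_jk : j <= k by apply: leq_subr.
have := coupled_ports s le_jk cp; rewrite es.
case es2: (nb2 _ _) => [[v2 b2]|] // [eqc].
set s2 := swap_ports c1 c2 s in es2 *.
have nc2 : c2 != Some s2.
  apply: contra nc => /eqP ec2; case: cp => _ _ _; rewrite /s2 in ec2.
  case: c1 ec2 {s2 es2 p12 p21 ew2 e0} => [b|]; case: c2 => // b' /=; rewrite /swap_ports.
  move=> [eb] _; apply/eqP; congr Some.
  by apply: (@perm_inj _ (tperm b b')); rewrite tpermL.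
exists (rcons w2 s2), v2, (Some b2); split.
- by rewrite pair_walk_rcons p12 /= (negbTE nc) es es2.
- by rewrite pair_walk_rcons p21 /= (negbTE nc2) es2 swap_portsK es.
- by rewrite walk_rcons ew2 /= (negbTE nc2) es2.
- by rewrite !size_rcons sz2.
rewrite subSS -/j; case: cp => q1 q2 same _; split.
- exact: (proj1 col1) es.
- exact: (proj1 col2) es2.
- exact: same_uptoP.
exists x1, s, x2, s2; split; [exact: inv1|exact: inv2|].
by move=> i le_i; apply: same; apply: leqW.
Qed.

End TwoGraphs.

Variables (nb1 nb2 : V -> P -> option (V * P)) (Q1 Q2 : pred V) (u1 u2 : V).
Hypotheses (inv1 : involutive_ports nb1) (inv2 : involutive_ports nb2).
Hypotheses (col1 : colored nb1 Q1) (col2 : colored nb2 Q2).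
Hypotheses (Qu1 : Q1 u1) (Qu2 : Q2 u2) (colu : col k.+1 u1 = col k.+1 u2).
Hypotheses (uniq1 : unique_ends nb1 u1 k.+1) (uniq2 : unique_ends nb2 u2 k.+1).

(** [phi] sends the end of a walk from [u1] to the end of the coupled walk from [u2]. Unique ends in
    the first graph make this well defined, in the second graph injective. Walks of length [k.+1]
    reach the neighbours of the ball of radius [k]. *)
Lemma local_isomorphism : exists phi : {perm V}, phi u1 = u2 /\
  forall v, walk_ball nb1 u1 k v ->
    [/\ Q1 v, Q2 (phi v), col 1 v = col 1 (phi v) &
        forall x, port_adj nb1 v x = port_adj nb2 (phi v) (phi x)].
Proof.
pose end_of (w : (k.+1).-bseq P) v := omap fst (walk nb1 (u1, None) w) == Some v.
pose f v := if [pick w | end_of w v] is Some w then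
  (if pair_walk nb1 nb2 u1 u2 w is Some (_, _, (v2, _)) then v2 else v) else v.
have fE w v1 a1 w2 st v2 a2 : walk nb1 (u1, None) w = Some (v1, a1) ->
    size w <= k.+1 -> pair_walk nb1 nb2 u1 u2 w = Some (w2, st, (v2, a2)) -> f v1 = v2.
  move=> ew le_w pw; rewrite /f; case: pickP => [w' /eqP|/(_ (Bseq le_w))].
    case ew': (walk _ _ _) => [[x a]|] // [ex]; rewrite ex in ew'.
    by rewrite (uniq1 ew' ew) ?pw // size_bseq.
  by rewrite /end_of ew eqxx.
have [phi phiE] : exists phi : {perm V}, {in [set v | [exists w, end_of w v]], phi =1 f}.
  apply: extend_to_perm => v v'; rewrite !inE.
  move=> /existsP[w /eqP ew] /existsP[w' /eqP ew'].
  case ew: (walk _ _ _) ew => [[x a]|] // [ex]; rewrite {x}ex in ew.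
  case ew': (walk _ _ _) ew' => [[x a']|] // [ex]; rewrite {x}ex in ew'.
  have [w2 [v2 [a2 [p12 p21 ew2 sz2 _]]]] :=
    pair_walkP inv1 inv2 col1 col2 Qu1 Qu2 colu ew (size_bseq w).
  have [w2' [v2' [a2' [p12' p21' ew2' sz2' _]]]] :=
    pair_walkP inv1 inv2 col1 col2 Qu1 Qu2 colu ew' (size_bseq w').
  rewrite (fE _ _ _ _ _ _ _ ew _ p12) ?size_bseq // (fE _ _ _ _ _ _ _ ew' _ p12') ?size_bseq //.
  move=> ev2; rewrite -{}ev2 in ew2'.
  have e2 := uniq2 ew2 ew2'; rewrite sz2 sz2' !size_bseq in e2.
  have {}e2 := e2 isT isT; move: p21; rewrite e2 p21' => -[].
  by move=> _ _ _ ->.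
have phiW w v1 a1 w2 st v2 a2 : walk nb1 (u1, None) w = Some (v1, a1) ->
    size w <= k.+1 -> pair_walk nb1 nb2 u1 u2 w = Some (w2, st, (v2, a2)) -> phi v1 = v2.
  move=> ew le_w pw; rewrite phiE; first exact: (fE _ _ _ _ _ _ _ ew le_w pw).
  by rewrite inE; apply/existsP; exists (Bseq le_w); rewrite /end_of ew.
exists phi; split; first by apply: (phiW [::]).
move=> v [w [a [le_w ew]]]; have le_w1 := leqW le_w.
have [w2 [v2 [a2 [p12 p21 ew2 sz2 cp]]]] :=
  pair_walkP inv1 inv2 col1 col2 Qu1 Qu2 colu ew le_w1.
have ephi := phiW _ _ _ _ _ _ _ ew le_w1 p12.
rewrite ephi; move: (cp) => [q1 q2 same _]; split=> //; first by apply: same; rewrite subSn.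
rewrite subSn // in cp.
(* The arrival port leads back along both walks; every other port extends both. *)
have core s : omap fst (nb2 v2 (swap_ports a a2 s)) = omap phi (omap fst (nb1 v s)).
  have [ea|na] := eqVneq a (Some s).
    rewrite ea in ew p12 cp *; case: cp => _ _ _; case: a2 => // b2 in ew2 p12 p21 *.
    rewrite {1}/swap_ports tpermL.
    have [w' [s0 [x [a0 [ew' ewalk na0 ->]]]]] := walk_arrival inv1 ew.
    rewrite ew' size_rcons in le_w1 p12.
    have [w2' [v2' [a2' [p12' _ _ _ _]]]] :=
      pair_walkP inv1 inv2 col1 col2 Qu1 Qu2 colu ewalk (ltnW le_w1).
    rewrite /= (phiW _ _ _ _ _ _ _ ewalk (ltnW le_w1) p12').
    move: p12; rewrite pair_walk_rcons p12' /= (negbTE na0).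
    case: (nb1 x s0) => [[? ?]|] //; case e2: (nb2 v2' _) => [[x2 b2']|] //.
    by move=> [_ _ _ ex2 eb2] _; rewrite -ex2 -eb2 (inv2 e2).
  have := coupled_ports col1 col2 s (leq_subr _ _) cp.
  case es: (nb1 v s) => [[x b]|]; case es2: (nb2 _ _) => [[x2 b2]|] //= _; congr Some.
  have ew' : walk nb1 (u1, None) (rcons w s) = Some (x, Some b).
    by rewrite walk_rcons ew /= (negbTE na) es.
  have p' : pair_walk nb1 nb2 u1 u2 (rcons w s) =
      Some (rcons w2 (swap_ports a a2 s), (x, Some b), (x2, Some b2)).
    by rewrite pair_walk_rcons p12 /= (negbTE na) es es2.
  by rewrite (phiW _ _ _ _ _ _ _ ew' _ p') // size_rcons.
move=> x; apply/existsP/existsP => -[s /eqP es].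
  by exists (swap_ports a a2 s); rewrite core es.
exists (swap_ports a2 a s).
move: es; rewrite -{1}(swap_portsK a2 a s) core.
by case: (nb1 _ _) => [[y b]|] //= [/perm_inj->].
Qed.

End Coupling.

(** * Lifts along a group *)

Section Lift.
Variables (B P : finType) (step : B -> P -> option (B * P)).
Variables (F : finFieldType) (gT : finGroupType) (L : bool -> F -> gT) (D : nat).
Variable iota : P -> F.
Hypothesis step_inv : involutive_ports step.
Hypothesis Lfree : alternating_free D L.
Hypothesis iota_inj : injective iota.
Local Open Scope group_scope.

(** The side [t] makes the lift bipartite even where the base has loops, and selects the subgroup of
    the letter, so that the types alternate along a walk. *)
Definition lift_step (v : bool * B * gT) (s : P) : option (bool * B * gT * P) :=
  let: (t, b, g) := v in
  omap (fun x => (~~ t, x.1, g * L t (iota s) * (L (~~ t) (iota x.2))^-1, x.2))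
    (step b s).

Lemma lift_inv : involutive_ports lift_step.
Proof.
move=> [[t b] g] s v' s' /=; case es: (step b s) => [[b' s0]|] //= [<- <-].
by rewrite /= (step_inv es) /= negbK mulgKV mulgK.
Qed.

Lemma lift_adj_side v x : port_adj lift_step v x -> x.1.1 = ~~ v.1.1.
Proof.
case: v => [[t b] g] /port_adjP[s [s' /=]].
by case: (step b s) => [[b' s0]|] //= [<-].
Qed.

Let LD t x y : L t (x + y)%R = L t x * L t y.
Proof. by case: Lfree. Qed.

Let L0 t : L t 0%R = 1.
Proof. by apply: (mulgI (L t 0%R)); rewrite -LD addr0 mulg1. Qed.

Let LV t x y : L t (x - y)%R = (L t y)^-1 * L t x.
Proof. by apply: (mulgI (L t y)); rewrite -LD addrC subrK mulKVg. Qed.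

Lemma walk_None nb (w : seq P) : foldl (walk_step (V := (bool * B * gT)%type) nb) None w = None.
Proof. by elim: w. Qed.

Lemma walk_cons nb st s (w : seq P) : walk nb st (s :: w) =
  if walk_step (V := (bool * B * gT)%type) nb (Some st) s is Some st' then walk nb st' w else None.
Proof. by rewrite /walk /=; case: st => v a; case: (if _ then _ else _) => // *; rewrite walk_None. Qed.

(* Multiplying the group coordinate by the letter of the arrival port makes the
   letters telescope into the differences between the departure port and the
   arrival port at each vertex of the walk. *)
Lemma lift_walk w v a t' b' g' a' :
  walk lift_step (v, Some a) w = Some ((t', b', g'), a') ->
  exists d c, [/\ a' = Some c, size d = size w, all (fun x => x != 0)%R d,
    t' = v.1.1 (+) odd (size w) &
    g' * L t' (iota c) = v.2 * L v.1.1 (iota a) * alt_word L v.1.1 d].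
Proof.
elim: w v a => [|s w IH] [[t b] g] a /=.
  by move=> [<- _ <- <-]; exists [::], a; rewrite addbF mulg1.
rewrite /walk /=; case: eqP => [_|/eqP nas]; first by rewrite walk_None.
case es: (step b s) => [[b1 s1]|] /=; last by rewrite walk_None.
move=> /IH[d [c [-> szd nzd -> eg]]] /=.
exists ((iota s - iota a)%R :: d), c; split=> //=; first by rewrite szd.
- rewrite nzd andbT subr_eq0; apply: contra nas => /eqP/iota_inj->; exact: eqxx.
- by rewrite addNb addbN.
rewrite /= in eg.
by rewrite eg mulgKV LV !mulgA mulgK.
Qed.

(** Without an arrival port at the start, the first letter is [iota s] itself; it may be zero and is
    kept apart from the nonzero letters [d]. *)
Lemma lift_first w s v a t' b' g' a' :
  walk lift_step (v, a) (s :: w) = Some ((t', b', g'), a') ->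
  exists d c, [/\ a' = Some c, size d = size w, all (fun x => x != 0)%R d,
    t' = ~~ v.1.1 (+) odd (size w) &
    g' * L t' (iota c) = v.2 * L v.1.1 (iota s) * alt_word L (~~ v.1.1) d].
Proof.
case: v => [[t b] g]; rewrite /walk /=; case: eqP => _; first by rewrite walk_None.
case es: (step b s) => [[b1 s1]|] /=; last by rewrite walk_None.
move=> /lift_walk[d [c [-> szd nzd et eg]]]; exists d, c; split=> //.
by rewrite eg /= mulgKV.
Qed.

Lemma alt_word_rcons t w x :
  alt_word L t (rcons w x) = alt_word L t w * L (t (+) odd (size w)) x.
Proof.
elim: w t => [|y w IH] t /=; first by rewrite addbF mul1g mulg1.
by rewrite IH mulgA addNb addbN.
Qed.

Let nz := (fun x : F => x != 0)%R.

Lemma alt_word_neq t w1 w2 : all nz w1 -> all nz w2 ->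
  size w1 <= D -> size w2 <= D -> 0 < size w1 + size w2 ->
  alt_word L t w1 <> alt_word L (~~ t) w2.
Proof.
case: Lfree => _ H nz1 nz2 le1 le2 gt0; case: t => [|/esym]; first exact: H.
by apply: H; rewrite // addnC.
Qed.

(** Here [y] is the difference of the two first ports and [x] that of the two last arrival ports,
    which may vanish. The two sides are alternating words with first letters of different types. *)
Lemma diverging_walks t d1 d2 (x y : F) : all nz d1 -> all nz d2 ->
  size d1 < D -> size d2 < D -> (y != 0)%R ->
  alt_word L (~~ t) d1 * L (~~ t (+) odd (size d1)) x <> alt_word L t (y :: d2).
Proof.
move=> nz1 nz2 le1 le2 y0.
have [->|x0] := eqVneq x 0%R.
  rewrite L0 mulg1 => /esym; apply: alt_word_neq => //=; last exact: ltnW.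
  by rewrite /nz y0.
rewrite -alt_word_rcons => /esym; apply: alt_word_neq => //=.
- by rewrite /nz y0.
- by rewrite all_rcons nz1 andbT /nz x0.
- by rewrite size_rcons.
Qed.

(** A closed walk has even length because the sides alternate, so [d] is an alternating word of odd
    length. It would equal the letter [c - s] of the other type, or the empty word. *)
Lemma closed_walk t d (s c : F) : all nz d -> size d < D -> odd (size d) ->
  L t s * alt_word L (~~ t) d <> L t c.
Proof.
move=> nzd le odd_d /(congr1 (mulg (L t s)^-1)); rewrite mulKg -LV.
have [->|x0] := eqVneq (c - s)%R 0%R.
  rewrite L0 => e; apply: (@alt_word_neq (~~ t) d [::]) => //=; first exact: ltnW.
  by rewrite addn0; case: size odd_d.
move=> e; apply: (@alt_word_neq (~~ t) d [:: (c - s)%R]) => //=.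
- by rewrite /nz x0.
- exact: ltnW.
- exact: leq_trans le.
- by rewrite addn1.
by rewrite negbK mulg1.
Qed.

(** Once the common prefix is removed, either one walk is empty and the other closed, or they leave
    through different ports. *)
Lemma lift_walk_inj w1 w2 v a x a1 a2 :
  walk lift_step (v, a) w1 = Some (x, a1) -> walk lift_step (v, a) w2 = Some (x, a2) ->
  size w1 <= D -> size w2 <= D -> w1 = w2.
Proof.
elim: w1 w2 v a => [|s1 w1 IH] [|s2 w2] v a //.
- case: v => [[t b] g] [<- _]; move=> /lift_first[d [c [_ szd nzd et eg]]] _ /= le2.
  case: (@closed_walk t d (iota s2) (iota c)); rewrite ?szd //.
    by move: et; case: t {eg}; case: odd.
  by apply: (mulgI g); rewrite mulgA -eg.
- case: v => [[t b] g] + [ex _]; rewrite -{}ex.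
  move=> /lift_first[d [c [_ szd nzd et eg]]] /= le2 _.
  case: (@closed_walk t d (iota s1) (iota c)); rewrite ?szd //.
    by move: et; case: t {eg}; case: odd.
  by apply: (mulgI g); rewrite mulgA -eg.
have [->|ns] := eqVneq s1 s2.
  rewrite !walk_cons; case: (walk_step lift_step (Some (v, a)) s2) => [[v' a']|] //.
  by move=> e1 e2 le1 le2; rewrite (IH w2 v' a') //; apply: ltnW.
case: x v {IH} => [[t' b'] g'] [[t b] g] /lift_first[d1 [c1 [_ sz1 nz1 et1 eg1]]].
move=> /lift_first[d2 [c2 [_ sz2 nz2 et2 eg2]]] /= le1 le2.
rewrite /= in et1 et2 eg1 eg2.
have y0 : (iota s2 - iota s1 != 0)%R.
  by rewrite subr_eq0; apply: contra ns => /eqP/iota_inj->.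
rewrite -sz1 in le1; rewrite -sz2 in le2.
case: (@diverging_walks t _ _ (iota c2 - iota c1)%R _ nz1 nz2 le1 le2 y0).
rewrite /= sz1 -et1; apply: (mulgI (g * L t (iota s1))).
by rewrite LV !mulgA -eg1 mulgK LV !mulgA mulgK.
Qed.

Lemma lift_unique_ends v : unique_ends lift_step v D.
Proof. by move=> w1 w2 x a1 a2; apply: lift_walk_inj. Qed.

End Lift.

(** * The cluster tree *)

Section Words.
Variable k : nat.

Definition gapped := sorted (fun i j => j.+1 < i).

Lemma gap_trans : transitive (fun i j => j.+1 < i).
Proof. by move=> i j l; lia. Qed.

Lemma gapped_head i l : gapped (i :: l) -> forall j, j \in l -> j.+1 < i.
Proof. by move=> /(order_path_min gap_trans)/allP. Qed.

Lemma gapped_tail i l : gapped (i :: l) -> gapped l.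
Proof. by case: l => //= j l /andP[]. Qed.

Lemma gapped_cons i l : gapped l -> (forall j, j \in l -> j.+1 < i) -> gapped (i :: l).
Proof. by case: l => //= j l -> H; rewrite H ?mem_head. Qed.

Lemma gapped_notin i l : gapped (i :: l) -> i \notin l.
Proof. by move=> /gapped_head H; apply/negP => /H; lia. Qed.

Lemma gapped_size l : gapped l -> all (leq^~ k) l -> size l <= k.+1.
Proof.
move=> gl /allP le_k; rewrite -(size_iota 0 k.+1); apply: uniq_leq_size.
  apply: (sorted_uniq gap_trans) gl => i; apply/negbTE; rewrite -leqNgt; exact: leqnSn.
by move=> i /le_k; rewrite mem_iota add0n ltnS.
Qed.

(* A cluster is a set of groups without two consecutive ones, listed
   decreasingly. A vertex of cluster [i :: l] has [d ^ i.+1] parents, in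
   cluster [l], behind its ports of groups [0, ..., i.+1] (for [i = k], the
   parents are behind the ports of group [k] and there are no other
   neighbours); its ports of group [m > i.+1] lead to cluster [m :: i :: l]. *)
Definition word := {bseq k.+1 of 'I_k.+1}.
Definition letters (S : word) : seq nat := map val S.
Definition mkword (l : seq nat) : word := insub_bseq k.+1 (map inord l).

Lemma lettersK S : mkword (letters S) = S.
Proof.
apply: val_inj; rewrite /mkword /letters -map_comp.
rewrite (eq_map (g := id)) ?map_id; last by move=> i; rewrite /= inord_val.
by rewrite /insub_bseq val_insubd size_bseq.
Qed.

Lemma letters_le S : all (leq^~ k) (letters S).
Proof. by apply/allP => _ /mapP[i _ ->]; rewrite -ltnS ltn_ord. Qed.

Lemma mkwordK l : gapped l -> all (leq^~ k) l -> letters (mkword l) = l.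
Proof.
move=> gl le_k; rewrite /letters /mkword /insub_bseq val_insubd size_map gapped_size //=.
rewrite -map_comp -[RHS]map_id; apply/eq_in_map => i li /=.
by rewrite inordK // ltnS (allP le_k).
Qed.

Definition next_word (l : seq nat) m : option (seq nat) :=
  if l is i :: l' then
    if m <= i.+1 then if (i == k) && (m < k) then None else Some l'
    else Some (m :: l)
  else Some [:: m].

(** The letter that [next_word] adds or removes, hence the slot of the index in which the two ports
    of the edge are exchanged. *)
Definition moved_letter (l : seq nat) m :=
  if l is i :: _ then if m <= i.+1 then i else m else m.

(* The part of the word that shows at a vertex at distance [k.+1 - j] from the
   root of a view: group [i] looks like the root cluster as long as
   [i + j <= k]. *)
Fixpoint truncate j (l : seq nat) : seq nat :=
  if l is i :: l' then if i + j <= k then [::] else i :: truncate j.-1 l' else [::].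

Lemma truncate_truncate i j l : i <= j -> truncate i (truncate j l) = truncate i l.
Proof.
elim: l i j => [|a l IH] i j //= le_ij; case: ifP => [le_j|_ /=].
  by case: ifP => //; lia.
by case: ifP => // _; rewrite IH //; lia.
Qed.

(** The indistinguishability of the clusters. If group [i] shows as the root at level [j.+1], then a
    port of group [m <= i.+1] leads to a parent, whose head is below [i], while from the root it
    leads to [[:: m]]; both show as the root at level [j]. *)
Lemma next_word_truncate l j m : gapped l -> j <= k -> m <= k ->
  omap (truncate j) (next_word l m) = omap (truncate j) (next_word (truncate j.+1 l) m).
Proof.
case: l => [|i l] gl le_jk le_mk //=.
have lt_i := gapped_head gl.
have [le_k|gt_k] := leqP (i + j.+1) k; have [le_m|gt_m] := leqP m i.+1 => /=.
- have -> /= : (i == k) = false by lia.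
  rewrite (_ : m + j <= k); last by lia.
  case: l lt_i {gl} => //= i' l /(_ i' (mem_head _ _)) lt_i'.
  by rewrite ifT //; lia.
- by case: ifP => // _; rewrite ifT //; lia.
- by rewrite le_m; case: ifP => //= _; rewrite truncate_truncate.
rewrite (leqNgt m) gt_m /=; case: ifP => // _; case: ifP => // _.
by rewrite truncate_truncate //; lia.
Qed.

End Words.

Section ClusterTree.
Variables (k d : nat).
Hypothesis d1 : 1 < d.
Local Notation port := 'I_(d ^ k).
Local Notation word := (word k).
Local Notation mkword := (mkword k).
Local Notation next_word := (next_word k).

(** Port 0 alone is group 0, and group [m > 0] consists of the ports from [d ^ (m - 1)] to
    [d ^ m - 1]. *)
Definition grp (s : nat) := up_log d s.+1.

Lemma grp_le s m : (grp s <= m) = (s < d ^ m).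
Proof.
apply/idP/idP => [le_m|]; last exact: up_log_min.
by apply: leq_trans (up_logP _ d1) _; rewrite leq_exp2l.
Qed.

Lemma grp_port (s : port) : grp s <= k.
Proof. by rewrite grp_le. Qed.

Local Notation index := {ffun 'I_k -> port}.

(* An index stores, for each group [i < k], the port leading into that group
   along the tree if [i] is in the word, and the port leading back from it
   otherwise. Nothing is stored for [i = k]: such an edge has the same port
   number at both ends. *)
Definition get_port (e : index) i (s : port) := oapp e s (insub i).
Definition set_port (e : index) (i : nat) (s : port) : index :=
  [ffun j => if val j == i then s else e j].

Definition valid_index z (l : seq nat) (e : index) :=
  [&& gapped l, z ==> (0 \notin l) &
   [forall i : 'I_k, if val i \in l then grp (e i) == i else grp (e i) <= i.+1]].

(** Pairs that fail this remain as isolated vertices, so that the graphs for both values of [z]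
    share one vertex type. *)
Definition valid z (b : word * index) := valid_index z (letters b.1) b.2.

(* The flag [z] selects the graph in which the root cluster is matched with
   itself through port 0 instead of being joined to cluster [:: 0]. *)
Definition base_step z (b : word * index) (s : port) : option (word * index * port) :=
  let: (W, e) := b in
  if valid z b then
    if [&& z, letters W == [::] & grp s == 0] then Some (b, s)
    else omap (fun l => let i := moved_letter (letters W) (grp s) in
                        (mkword l, set_port e i s, get_port e i s))
              (next_word (letters W) (grp s))
  else None.

Lemma set_portK e i s : set_port (set_port e i s) i (get_port e i s) = e.
Proof.
apply/ffunP => j; rewrite !ffunE; case: eqP => // ej.
by rewrite /get_port -ej valK.
Qed.

Lemma get_set_port e i s : get_port (set_port e i s) i (get_port e i s) = s.
Proof.
rewrite /get_port; case: insubP => [j lt ej|//] /=.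
by rewrite ffunE ej eqxx.
Qed.

Lemma get_port_big e s : get_port e k s = s.
Proof. by rewrite /get_port insubF // ltnn. Qed.

Lemma get_port_lt e i s (lt : i < k) : get_port e i s = e (Ordinal lt).
Proof. by rewrite /get_port insubT. Qed.

Lemma valid_grp z l e (i : 'I_k) : valid_index z l e ->
  if val i \in l then grp (e i) == i else grp (e i) <= i.+1.
Proof. by case/and3P => _ _ /forallP/(_ i). Qed.

Lemma valid_index_set z l l' e i (s : port) : valid_index z l e ->
  gapped l' -> (z ==> (0 \notin l')) ->
  (forall j, j != i -> (j \in l') = (j \in l)) ->
  (i < k -> if i \in l' then grp s == i else grp s <= i.+1) ->
  valid_index z l' (set_port e i s).
Proof.
move=> val_e gl' zl' eql' grp_s; apply/and3P; split=> //; apply/forallP => j.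
rewrite ffunE; have [ej|nj] := eqVneq (val j) i; first by subst i; exact: (grp_s (ltn_ord j)).
by rewrite eql' //; exact: (valid_grp j val_e).
Qed.

(** The stored port undoes the step. After a step to a child it lies in a group up to [m.+1] and
    leads to the parent; after a step to a parent it lies in group [i] and leads to the child. For
    [i = k] the port [s] itself does both. *)
Lemma next_word_back z l e (s : port) l' :
  let i := moved_letter l (grp s) in let s' := get_port e i s in
  valid_index z l e -> all (leq^~ k) l -> ~~ [&& z, l == [::] & grp s == 0] ->
  next_word l (grp s) = Some l' ->
  [/\ all (leq^~ k) l', valid_index z l' (set_port e i s),
      next_word l' (grp s') = Some l, moved_letter l' (grp s') = i &
      ~~ [&& z, l' == [::] & grp s' == 0]].
Proof.
have le_m := grp_port s; set m := grp s in le_m *.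
move=> i s' val_e le_k nz; have [gl zl _] := and3P val_e.
have child : l' = m :: l -> i = m -> (forall j, j \in l -> j.+1 < m) ->
  (if l is j :: _ then j.+1 < m else true) ->
  [/\ all (leq^~ k) l', valid_index z l' (set_port e i s),
      next_word l' (grp s') = Some l, moved_letter l' (grp s') = i &
      ~~ [&& z, l' == [::] & grp s' == 0]].
  move=> -> ei lt_m hd_m; have nm : m \notin l by apply/negP => /lt_m; lia.
  have s'_m : grp s' <= m.+1 /\ (m = k -> grp s' = k).
    rewrite /s' ei; move: le_m; rewrite leq_eqVlt => /orP[/eqP em|lt].
      by rewrite em get_port_big -/m em.
    rewrite get_port_lt; split; last by lia.
    by have := valid_grp (Ordinal lt) val_e; rewrite /= (negbTE nm).
  case: s'_m => le_s' s'_k; rewrite ei /= le_s'; split=> //.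
  - by rewrite /= le_m.
  - apply: (valid_index_set val_e) => //.
    + exact: gapped_cons.
    + apply/implyP => zT; rewrite inE negb_or (implyP zl zT) andbT eq_sym.
      apply: contra nz => m0; rewrite zT m0 andbT /=.
      by case: (l) lt_m => // j ? /(_ j (mem_head _ _)); rewrite (eqP m0).
    + by move=> j nj; rewrite inE (negbTE nj).
    + by rewrite mem_head /m eqxx.
  - by case: eqP => [/s'_k->|//]; rewrite ltnn.
  by rewrite andbF.
case: l => [|i0 l] in i s' val_e le_k nz gl zl child *.
  by move=> [el']; apply: child.
rewrite /= in i s' val_e child *; have [le_mi|lt_im] := leqP m i0.+1; last first.
  move=> [el']; apply: child => //; first by rewrite /i leqNgt lt_im.
  move=> j; rewrite inE => /orP[/eqP-> //|/(gapped_head gl)]; lia.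
have ei : i = i0 by rewrite /i le_mi.
case: ifP => // m_k [<-]; have {child}lt_i := gapped_head gl.
have /andP[le_i0 le_kl] := le_k; have ni := gapped_notin gl.
have s'_i : grp s' = i0.
  rewrite /s' ei; move: le_i0; rewrite leq_eqVlt => /orP[/eqP ek|lt].
    by move: m_k; rewrite ek eqxx get_port_big /= -/m; lia.
  rewrite get_port_lt; apply/eqP.
  by have := valid_grp (Ordinal lt) val_e; rewrite /= mem_head.
rewrite ei s'_i; split=> //.
- apply: (valid_index_set val_e) => //; first exact: gapped_tail gl.
  + by apply/implyP => zT; move: (implyP zl zT); rewrite inE negb_or => /andP[].
  + by move=> j nj; rewrite inE (negbTE nj).
  + by rewrite (negbTE ni).
- case: l lt_i {val_e le_k nz gl zl i s' ei s'_i le_kl ni} => //= j l /(_ j (mem_head _ _)).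
  by move=> lt; rewrite leqNgt lt.
- case: l lt_i {val_e le_k nz gl zl i s' ei s'_i le_kl ni} => //= j l /(_ j (mem_head _ _)).
  by move=> lt; rewrite leqNgt lt.
apply/negP => /and3P[zT _ /eqP i00].
by move: (implyP zl zT); rewrite i00 mem_head.
Qed.

Lemma base_stepP z b s b' s' : base_step z b s = Some (b', s') ->
  valid z b' /\ base_step z b' s' = Some (b, s).
Proof.
case: b => W e; rewrite /base_step; case: ifP => // val_b; case: ifP => [zS|/negbT nzS].
  by case=> <- <-; rewrite val_b zS.
case el': (next_word _ _) => [l'|] //= [<- <-].
have [le_k' val' back moved nz'] := next_word_back val_b (letters_le W) nzS el'.
have gl' : gapped l' by case/and3P: val'.
have val_b' : valid z (mkword l', set_port e (moved_letter (letters W) (grp s)) s).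
  by rewrite /valid /= mkwordK.
split=> //; rewrite val_b' /= mkwordK // (negbTE nz') back /= moved.
by rewrite lettersK set_portK get_set_port.
Qed.

Lemma base_step_inv z : involutive_ports (base_step z).
Proof. by move=> b s b' s' /base_stepP[]. Qed.

End ClusterTree.

(** * The lifted cluster graph *)

Section HardGraph.
Variables (k d : nat) (F : finFieldType) (gT : finGroupType) (L : bool -> F -> gT).
Variable iota : 'I_(d ^ k) -> F.
Hypotheses (k0 : 0 < k) (d1 : 1 < d).
Hypothesis Lfree : alternating_free k.+1 L.
Hypothesis iota_inj : injective iota.

Definition node := (bool * (word k * {ffun 'I_k -> 'I_(d ^ k)}) * gT)%type.
HB.instance Definition _ := Finite.on node.

Definition node_step z : node -> 'I_(d ^ k) -> option (node * 'I_(d ^ k)) :=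
  lift_step (@base_step k d z) L iota.

Definition node_letters (v : node) : seq nat := letters v.1.2.1.
Definition node_valid z : pred node := fun v => valid z v.1.2.
Definition node_adj z : rel node := port_adj (node_step z).

(** The vertices of weight 1. Validity is taken for the flag [false], so both graphs get the same
    weights. *)
Definition real_node : pred node :=
  fun v => node_valid false v && (k \notin node_letters v).
Definition root_node : pred node :=
  fun v => node_valid false v && (node_letters v == [::]).

Definition node_color j (v : node) := truncate k j (node_letters v).

Lemma node_step_inv z : involutive_ports (node_step z).
Proof. by apply: lift_inv; apply: base_step_inv. Qed.

Lemma node_adj_sym z : symmetric (node_adj z).
Proof. exact/port_adj_sym/node_step_inv. Qed.

Lemma node_adj_side z v x : node_adj z v x -> x.1.1 = ~~ v.1.1.
Proof. exact: lift_adj_side. Qed.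

Lemma node_unique_ends z v : unique_ends (node_step z) v k.+1.
Proof. exact: lift_unique_ends. Qed.

Lemma node_stepP z v s x s' : node_step z v s = Some (x, s') ->
  base_step z v.1.2 s = Some (x.1.2, s').
Proof.
by case: v => [[t b] g] /=; case: (base_step z b s) => [[b' s0]|] //= [<- <-].
Qed.

Lemma node_step_some z v s b s' : base_step z v.1.2 s = Some (b, s') ->
  exists x, node_step z v s = Some (x, s') /\ x.1.2 = b.
Proof. by case: v => [[t b0] g] /= ->; eexists; split. Qed.

Lemma node_adj_valid z v x : node_adj z v x -> node_valid z v && node_valid z x.
Proof.
case/port_adjP => s [s' /node_stepP es]; have [] := base_stepP d1 es.
rewrite /node_valid => -> _; rewrite andbT.
by case: v.1.2 es => W e; rewrite /base_step; case: ifP.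
Qed.

(** The rule does not depend on [z]: a matching edge leads to the empty word where the rule predicts
    [[:: 0]], and [truncate] erases that letter as [j <= k]. *)
Lemma node_colored z :
  colored node_color (fun j l (s : 'I_(d ^ k)) => omap (truncate k j) (next_word k l (grp d s))) k
          (node_step z) (node_valid z).
Proof.
split=> [v s x s' _ es|j v s le_j val_v].
  by have [] := base_stepP d1 (node_stepP es).
have -> : omap (fun x => node_color j x.1) (node_step z v s) =
          omap (fun x => truncate k j (letters x.1.1)) (base_step z v.1.2 s).
  by case: v {val_v} => [[t b] g] /=; case: base_step => [[b' s0]|].
rewrite /node_color -next_word_truncate //; last exact: grp_port.
  rewrite /node_letters; move: val_v; rewrite /node_valid.
  case: v.1.2 => W e /= val_v; rewrite val_v.
  case: ifP => [/and3P[_ /eqP eW /eqP e0]|/negbT nz].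
    by rewrite /= e0 eW /= add0n le_j.
  case el: (next_word _ _ _) => [l'|] //=.
  have [le_l' /and3P[gl' _ _] _ _ _] := next_word_back d1 val_v (letters_le W) nz el.
  by rewrite mkwordK.
by case/and3P: val_v.
Qed.

Lemma node_color_truncate j v :
  node_color j v = truncate k j (node_color j.+1 v).
Proof. by rewrite /node_color truncate_truncate. Qed.

Lemma node_valid_false z v : node_valid z v -> node_valid false v.
Proof. by case/and3P => gl _ el; apply/and3P. Qed.

(** Level 1, reached at distance [k], still tells group [k] from the root, so weights agree on the
    whole ball. *)
Lemma real_node_color v : node_valid false v -> real_node v = (node_color 1 v == [::]).
Proof.
rewrite /real_node /node_color => val_v; rewrite val_v /=.
case/and3P: val_v (letters_le v.1.2.1); rewrite -/(node_letters v).
case: (node_letters v) => [|i l] //= /gapped_head lt_i _ _ /andP[le_i le_l].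
rewrite inE negb_or addn1; case: ltnP => [lt_ik|le_ki].
  rewrite eqxx gtn_eqF //=; apply/negP => /lt_i; lia.
by rewrite (_ : i = k) ?eqxx //; lia.
Qed.

Lemma root_real v : root_node v -> real_node v.
Proof. by case/andP=> val_v /eqP el; rewrite /real_node val_v el. Qed.

Lemma root_independent v x : node_adj false v x -> root_node v -> ~~ root_node x.
Proof.
case/port_adjP => s [s' es] /andP[val_v /eqP el].
have [val_x _] := base_stepP d1 (node_stepP es).
rewrite /root_node negb_and; apply/orP; right.
have := node_stepP es; rewrite /node_valid /node_letters in val_v el *.
case: v.1.2 val_v el => W e /= -> -> /= [ex _].
by rewrite -ex mkwordK //= grp_port.
Qed.

Lemma port0_lt : 0 < d ^ k. Proof. by rewrite expn_gt0 ltnW. Qed.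
Definition port0 : 'I_(d ^ k) := Ordinal port0_lt.

Lemma grp_port0 : grp d port0 = 0.
Proof. by apply/eqP; rewrite -leqn0 grp_le. Qed.

Definition some_root : node := (true, (mkword k [::], [ffun=> port0]), 1%g).

Lemma some_root_letters : node_letters some_root = [::].
Proof. by rewrite /node_letters mkwordK. Qed.

Lemma some_root_valid z : node_valid z some_root.
Proof.
rewrite /node_valid /valid /= mkwordK //; apply/and3P; split=> //; first by rewrite implybT.
by apply/forallP => i; rewrite ffunE grp_port0.
Qed.

Lemma some_root_step z s : base_step z some_root.1.2 s =
  if z && (grp d s == 0) then Some (some_root.1.2, s)
  else let e := some_root.1.2.2 in
    Some (mkword k [:: grp d s], set_port e (grp d s) s, get_port e (grp d s) s).
Proof.
have := some_root_valid z; rewrite /node_valid /base_step /some_root /= => ->.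
by rewrite mkwordK //=; case: ifP.
Qed.

(** The base step is a loop, which the side bit of the lift turns into an edge between two nodes. *)
Lemma matched_roots : exists x, [/\ node_adj true some_root x, node_valid true x &
  node_letters x = [::]].
Proof.
have es : base_step true some_root.1.2 port0 = Some (some_root.1.2, port0).
  by rewrite some_root_step grp_port0.
have [x [ex eb]] := node_step_some es.
exists x; split; first by apply/port_adjP; exists port0, port0.
  by rewrite /node_valid eb; apply: some_root_valid.
by rewrite /node_letters eb; apply: some_root_letters.
Qed.

Lemma root_some_root : root_node some_root.
Proof. by rewrite /root_node some_root_valid some_root_letters. Qed.

Lemma real_neighbour_of_root : exists x, node_adj false some_root x && real_node x.
Proof.
have [x [ex eb]] := node_step_some (some_root_step false port0).
have adj_x : node_adj false some_root x by apply/port_adjP; exists port0; eexists; exact: ex.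
exists x; rewrite adj_x /real_node; case/andP: (node_adj_valid adj_x) => _ -> /=.
by rewrite /node_letters eb /= grp_port0 mkwordK //= inE gtn_eqF.
Qed.

Lemma root_local_isomorphism x x' : root_node x -> node_valid true x' ->
  node_letters x' = [::] ->
  exists phi : {perm node}, phi x = x' /\
    forall v, walk_ball (node_step false) x k v ->
      real_node v = real_node (phi v) /\
      forall y, node_adj false v y = node_adj true (phi v) (phi y).
Proof.
case/andP => val_x /eqP el val_x' el'.
have ecol : node_color k.+1 x = node_color k.+1 x' by rewrite /node_color el el'.
have [phi [phix iso]] := local_isomorphism node_color_truncate
  (@node_step_inv false) (@node_step_inv true) (node_colored false) (node_colored true)
  val_x val_x' ecol (@node_unique_ends false x) (@node_unique_ends true x').
exists phi; split=> // v /iso[val_v val_v' ec adj]; split=> //.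
by rewrite !real_node_color ?ec //; apply: node_valid_false val_v'.
Qed.

Lemma card_node_adj z v : #|[set x | node_adj z v x]| <= d ^ k.
Proof.
rewrite -[d ^ k]card_ord -cardsT.
apply: leq_trans (leq_imset_card (fun s => oapp fst v (node_step z v s)) _).
apply/subset_leq_card/subsetP => x; rewrite inE => /port_adjP[s [s' es]].
by apply/imsetP; exists s; rewrite ?inE // es.
Qed.

Lemma card_root_adj : d ^ k <= #|[set x | node_adj false some_root x]|.
Proof.
have ex s : exists xs, node_step false some_root s = Some xs.
  by have [x [? _]] := node_step_some (some_root_step false s); eexists; eauto.
pose f s := oapp fst some_root (node_step false some_root s).
rewrite -[d ^ k]card_ord -cardsT -(card_imset (f := f)).
  apply/subset_leq_card/subsetP => _ /imsetP[s _ ->]; rewrite inE /f.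
  by have [[x s'] es] := ex s; rewrite es /=; apply/port_adjP; exists s, s'.
move=> s1 s2; rewrite /f.
have [[x1 s1'] es1] := ex s1; have [[x2 s2'] es2] := ex s2.
rewrite es1 es2 /= => e; rewrite e in es1.
have w1 : walk (node_step false) (some_root, None) [:: s1] = Some (x2, Some s1').
  by rewrite walk1 es1.
have w2 : walk (node_step false) (some_root, None) [:: s2] = Some (x2, Some s2').
  by rewrite walk1 es2.
by case: (node_unique_ends w1 w2 isT isT).
Qed.

(** A node with head [i] yields [d] nodes of its parent cluster: the head is dropped, and the port
    in slot [i], below [d ^ i], gets a further base-[d] digit [c]. Division by [d] recovers both. *)
Lemma card_real_head (i : 'I_k) :
  #|[set v | real_node v && (ohead (node_letters v) == Some (val i))]| * d <=
  #|[set v | real_node v]|.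
Proof.
set A := [set v | _ && _].
pose f (vc : node * 'I_d) : node := let: ((t, (W, e), g), c) := vc in
  (t, (mkword k (behead (letters W)),
       set_port e i (insubd (e i) (d * e i + c))), g).
have lettersA v : v \in A -> node_letters v = val i :: behead (node_letters v).
  by rewrite inE => /andP[_]; case: (node_letters v) => //= j l /eqP[->].
have portA v c : v \in A -> val (insubd (v.1.2.2 i) (d * v.1.2.2 i + val c)) =
                    d * v.1.2.2 i + (c : 'I_d).
  move=> Av; rewrite val_insubd ifT //.
  have lt : v.1.2.2 i < d ^ i.
    rewrite -(grp_le d1); have := Av; rewrite inE => /andP[/andP[val_v _] _].
    have := valid_grp i val_v; rewrite -/(node_letters v) lettersA // mem_head.
    by move=> /eqP->.
  apply: (@leq_trans (d ^ i.+1)); last by rewrite leq_exp2l.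
  rewrite expnS; apply: (@leq_trans (d * (v.1.2.2 i).+1)); last by rewrite leq_mul2l lt orbT.
  by rewrite mulnS addnC ltn_add2r ltn_ord.
rewrite -[d in _ * d]card_ord -cardsT -cardsX.
rewrite -(card_in_imset (f := f)).
  apply/subset_leq_card/subsetP => _ /imsetP[[v c] /setXP[Av _] ->].
  have := portA _ c Av; have := lettersA _ Av; have := Av.
  rewrite !inE /real_node /node_valid /valid /node_letters.
  case: v Av => [[t [W e]] g] Av /=; set l := behead _ => /andP[/andP[val_v nk] _] el portE.
  have le_l : all (leq^~ k) l by have := letters_le W; rewrite el => /andP[].
  have gl : gapped (val i :: l) by rewrite -el; case/and3P: val_v.
  rewrite mkwordK //; last exact: gapped_tail gl.
  apply/andP; split; last by move: nk; rewrite el inE negb_or => /andP[].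
  apply: (valid_index_set val_v) => //; first exact: gapped_tail gl.
    by move=> j nj; rewrite el inE (negbTE nj).
  move=> _; rewrite (negbTE (gapped_notin gl)) (grp_le d1) portE.
  have lt : e i < d ^ i.
    rewrite -(grp_le d1); have := valid_grp i val_v; rewrite el mem_head.
    by move=> /eqP->.
  rewrite expnS; apply: (@leq_trans (d * (e i).+1)); last by rewrite leq_mul2l lt orbT.
  by rewrite mulnS addnC ltn_add2r ltn_ord.
move=> [v c] [v' c'] /setXP[Av _] /setXP[Av' _].
have := portA _ c Av; have := lettersA _ Av; have := portA _ c' Av'; have := lettersA _ Av'.
rewrite /node_letters; case: v Av => [[t [W e]] g] Av; case: v' Av' => [[t' [W' e']] g'] Av' /=.
move=> el' pE' el pE [<- eW ee <-].
have eqW : W = W'.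
  rewrite -(lettersK W) -(lettersK W') el el'; congr (mkword k (_ :: _)).
  have glW u : u \in A -> gapped (behead (node_letters u)) /\ all (leq^~ k) (behead (node_letters u)).
    move=> Au; have := Au; rewrite inE => /andP[/andP[/and3P[gl _ _] _] _].
    have := letters_le u.1.2.1; rewrite -/(node_letters u) in gl *.
    by rewrite lettersA //= => /andP[_ ->]; rewrite lettersA // in gl; rewrite (gapped_tail gl).
  have [g1 a1] := glW _ Av; have [g2 a2] := glW _ Av'.
  by rewrite -(mkwordK g1 a1) /node_letters /= eW mkwordK.
have/ffunP/(_ i) := ee; rewrite !ffunE eqxx => /(congr1 val) /=.
rewrite pE pE' => eqi.
have divE (a : nat) (b : 'I_d) : (d * a + b) %/ d = a.
  by rewrite mulnC divnMDl ?divn_small ?addn0 //; apply: ltnW.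
have eei : e i = e' i by apply: val_inj; move: (congr1 (divn^~ d) eqi); rewrite !divE.
have -> : c = c' by apply: val_inj; move: eqi; rewrite eei => /addnI.
congr (_, (_, _), _, _) => //; apply/ffunP => j.
have/ffunP/(_ j) := ee; rewrite !ffunE; case: eqP => // /val_inj-> //.
Qed.

(** Summing over the heads bounds [#|X| * d] by [k * (#|X| + #|Y|)], and [k.*2 <= d] absorbs the
    term in [#|X|]. *)
Lemma card_real_nonroot : k.*2 <= d ->
  #|[set v | real_node v && ~~ root_node v]| * d <= k.*2 * #|[set v | root_node v]|.
Proof.
move=> le_kd; set X := [set v | _ && _]; set Y := [set v | root_node v].
pose A i := [set v | real_node v && (ohead (node_letters v) == Some i)].
have subX : X \subset \bigcup_(i < k) A i.
  apply/subsetP => v; rewrite inE => /andP[rv nroot]; move: (rv) nroot.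
  rewrite /root_node => /andP[-> nk] /=; case el: (node_letters v) => [//|i l] _.
  have lt_ik : i < k.
    have := letters_le v.1.2.1; rewrite -/(node_letters v) el /= => /andP[le_ik _].
    by move: nk; rewrite el inE negb_or => /andP[]; lia.
  by apply/bigcupP; exists (Ordinal lt_ik); rewrite // inE rv el /=.
have le1 : #|X| * d <= k * #|[set v | real_node v]|.
  apply: (@leq_trans ((\sum_(i < k) #|A i|) * d)).
    rewrite leq_mul2r (leq_trans (subset_leq_card subX)) ?orbT //.
    elim/big_ind2: _ => [|b B c C leB leC|//]; first by rewrite cards0.
    by rewrite (leq_trans (leq_card_setU B C).1) ?leq_add.
  rewrite big_distrl /= -[k in k * _]card_ord -sum_nat_const.
  by apply: leq_sum => i _; apply: card_real_head.
have -> : #|Y| = #|[set v | real_node v && root_node v]|.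
  by apply: eq_card => v; rewrite !inE; case: (boolP (root_node v)) => [/root_real->|]; rewrite ?andbF.
have eqr : #|[set v | real_node v]| = #|[set v | real_node v && root_node v]| + #|X|.
  rewrite -(cardsID [set v | root_node v] [set v | real_node v]).
  by congr (_ + _); apply: eq_card => v; rewrite !inE // andbC.
by move: le1; rewrite eqr; nia.
Qed.

Lemma card_node : #|{: node}| = 2 * (#|{: word k}| * (d ^ k) ^ k) * #|gT|.
Proof. by rewrite !card_prod card_bool card_ffun !card_ord. Qed.

End HardGraph.

(** * Spanner instances from covering instances *)

Section EdgeSets.
Variables (T : finType) (a : rel T).

Lemma set2_eqP (x y z t : T) :
  [set x; y] = [set z; t] -> (x = z /\ y = t) \/ (x = t /\ y = z).
Proof.
move=> /setP e; have := e x; have := e y; have := e z; have := e t.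
rewrite !inE !eqxx ?orbT /=.
move=> /orP[]/eqP e1 /orP[]/eqP e2 /esym/orP[]/eqP e3 /esym/orP[]/eqP e4;
by (left; split; congruence) || (right; split; congruence).
Qed.

Definition edge_set : {set {set T}} :=
  [set e | [exists x, exists y, a x y && (e == [set x; y])]].

Lemma edge_setP e :
  reflect (exists x y, a x y /\ e = [set x; y]) (e \in edge_set).
Proof.
rewrite inE; apply: (iffP existsP) => [[x /existsP[y /andP[axy /eqP->]]]|[x [y [axy ->]]]].
  by exists x, y.
by exists x; apply/existsP; exists y; rewrite axy eqxx.
Qed.

Hypothesis asym : symmetric a.

Lemma mem_edge_set x y : ([set x; y] \in edge_set) = a x y.
Proof.
apply/edge_setP/idP => [[z [t [azt]]]|axy]; last by exists x, y.
by case/set2_eqP => -[-> ->] //; rewrite asym.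
Qed.

End EdgeSets.

Section SpannerGraph.
Variables (R : realFieldType) (V : finType) (k : nat) (r : pred V).
Definition svertex := (V * 'I_k.+3)%type.
HB.instance Definition _ := Finite.on svertex.

Definition consecutive m n := (m.+1 == n) || (n.+1 == m).

Definition link m n :=
  [|| consecutive m n, (m == 0) && (n == 2) | (m == 2) && (n == 0)].

Section OneGraph.
Variable E : rel V.
Hypothesis Esym : symmetric E.

(* Copies 0 and 1 of each vertex [v] of the covering problem carry the gadget
   of [v]; they span a triangle with copy 2. Copies [2, ..., k+2] form a path
   whose far ends are joined in a path through the whole vertex set: this makes
   the graph connected without being visible from the gadgets in [k] rounds. *)
Definition sadj : rel svertex := fun y z =>
  if y.1 == z.1 then link y.2 z.2
  else [&& y.2 < 2, z.2 < 2 & E y.1 z.1] ||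
       [&& y.2 == k.+2 :> nat, z.2 == k.+2 :> nat &
           consecutive (enum_rank y.1) (enum_rank z.1)].

(** The edges of weight 1. Those from copies 0 and 1 to copy 2 are free, so a gadget edge can be
    left out of a spanner at no cost. *)
Definition unit_pair : rel svertex := fun y z =>
  [&& y.2 < 2, z.2 < 2 &
      if y.1 == z.1 then r y.1 else E y.1 z.1 && (y.2 != z.2)].

Lemma sadj_sym : symmetric sadj.
Proof.
move=> [v a] [w b]; rewrite /sadj /= eq_sym; case: eqP => _.
  by rewrite /link /consecutive; lia.
by rewrite Esym; congr orb; rewrite /consecutive; lia.
Qed.

Lemma unit_pair_sym : symmetric unit_pair.
Proof.
move=> [v a] [w b]; rewrite /unit_pair /= eq_sym.
case: eqP => [->|_]; first by case: (_ < 2); case: (_ < 2).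
by rewrite Esym eq_sym; case: (_ < 2); case: (_ < 2).
Qed.

Lemma sadj_irr y : ~~ sadj y y.
Proof. by rewrite /sadj eqxx /link /consecutive; lia. Qed.

Lemma sadj_low (y z : svertex) : y.1 != z.1 -> (y.2 < 2) || (z.2 < 2) ->
  sadj y z = [&& y.2 < 2, z.2 < 2 & E y.1 z.1].
Proof.
move=> /negbTE nyz low; rewrite /sadj nyz; case: (E _ _); rewrite ?andbF ?andbT ?orbF //=.
  by apply/idP/idP => [|->//] /orP[//|/and3P[/eqP e1 /eqP e2 _]]; move: low; rewrite e1 e2.
by apply/negP => /and3P[/eqP e1 /eqP e2 _]; move: low; rewrite e1 e2.
Qed.

Lemma sedges_card2 e : e \in edge_set sadj -> #|e| = 2.
Proof.
case/edge_setP => y [z [adj ->]]; rewrite cards2.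
by case: eqP adj => // ->; rewrite (negbTE (sadj_irr z)).
Qed.

Lemma adjacent_edge_set (a : rel svertex) : symmetric a -> adjacent (edge_set a) =2 a.
Proof. by move=> asym y z; rewrite /adjacent mem_edge_set. Qed.

Lemma sadj_connected y z : connect (adjacent (edge_set sadj)) y z.
Proof.
rewrite (eq_connect (adjacent_edge_set sadj_sym)).
have csym := sym_connect_sym sadj_sym.
have chain v m : m <= k.+2 -> connect sadj (v, ord0) (v, inord m).
  elim: m => [|m IH] le_m; first by rewrite (_ : ord0 = inord 0) //; apply: val_inj; rewrite /= inordK.
  apply: connect_trans (IH (ltnW le_m)) (connect1 _).
  by rewrite /sadj /= eqxx /link /consecutive !inordK ?eqxx // ltnS ltnW.
have chain0 v a : connect sadj (v, ord0) (v, a).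
  by rewrite -(inord_val a); apply: chain; rewrite -ltnS.
have backbone n (v w : V) : enum_rank v = 0 :> nat -> enum_rank w = n :> nat ->
    connect sadj (v, ord0) (w, ord0).
  move=> ev; elim: n w => [|n IH] w ew.
    rewrite (_ : v = w) //; apply: enum_rank_inj; apply: val_inj.
    by rewrite /= ev ew.
  have lt_n : n < #|V| by have := ltn_ord (enum_rank w); rewrite ew; apply: ltnW.
  pose w' := enum_val (Ordinal lt_n).
  have ew' : enum_rank w' = n :> nat by rewrite enum_valK.
  apply: connect_trans (IH w' ew') _; apply: connect_trans (chain0 w' ord_max) _.
  apply: (@connect_trans _ _ (w, ord_max)); last by rewrite csym.
  apply: connect1; rewrite /sadj /=; case: eqP => [e|_].
    by move: ew; rewrite -e ew'; lia.
  by rewrite eqxx /consecutive ew ew' eqxx.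
case: y z => [v a] [w b].
have lt0 : 0 < #|V| by apply/card_gt0P; exists v.
pose o := enum_val (Ordinal lt0).
have eo : enum_rank o = 0 :> nat by rewrite enum_valK.
apply: (@connect_trans _ _ (o, ord0)).
  rewrite csym; apply: connect_trans (chain0 v a); exact: backbone eo erefl.
by apply: connect_trans (chain0 w b); exact: backbone eo erefl.
Qed.

Definition sweight (e : {set svertex}) : R := ((e \in edge_set unit_pair)%:R)%R.

Definition spanner_graph : wgraph R :=
  @WGraph R svertex (edge_set sadj) sweight sedges_card2 sadj_connected
    (fun e _ => ler0n R _).

Lemma cost_card (H : {set {set svertex}}) :
  cost (G := spanner_graph) H = (#|H :&: edge_set unit_pair|%:R)%R.
Proof.
rewrite /cost -sum1_card natr_sum big_mkcond [RHS]big_mkcond /=.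
apply: eq_bigr => e _; rewrite inE /sweight.
by case: (e \in H); case: (e \in _).
Qed.

(** The spanner keeps all free edges and the gadget edges of [Cov]. An omitted gadget edge is
    spanned through copy 2, an omitted edge between opposite copies through the gadget edge of an
    end that is covered or has weight 0. *)
Lemma opt_cost_le (Cov : {set V}) :
  (forall v w, E v w -> [|| v \in Cov, ~~ r v, w \in Cov | ~~ r w]) ->
  (opt_cost spanner_graph <= #|Cov|%:R)%R.
Proof.
move=> cov; pose keep y z := ~~ unit_pair y z || ((y.1 == z.1) && (y.1 \in Cov)).
pose a : rel svertex := fun y z => sadj y z && keep y z.
have asym : symmetric a.
  move=> y z; rewrite /a /keep sadj_sym unit_pair_sym eq_sym.
  by case: eqP => // ->.
have adjH := adjacent_edge_set asym.
have spanH : is_2spanner (G := spanner_graph) (edge_set a).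
  apply/andP; split.
    by apply/subsetP => _ /edge_setP[y [z [/andP[adj _] ->]]]; apply/edge_setP; exists y, z.
  apply/forallP => y; apply/forallP => z; apply/implyP.
  rewrite (adjacent_edge_set sadj_sym) => adj; apply/existsP.
  have [kyz|nk] := boolP (keep y z).
    by exists [bseq z]; rewrite /= adjH /a adj kyz /=.
  have two x : a y x -> a x z ->
      exists p : 2.-bseq svertex, path (adjacent (edge_set a)) y p && (last y p == z).
    by move=> yx xz; exists [bseq x; z]; rewrite /= !adjH yx xz /=.
  move: nk; rewrite negb_or negbK => /andP[uyz nCov].
  case: y z => [v p] [w q] in adj uyz nCov two *; move: uyz; rewrite /unit_pair /=.
  case/and3P => lt_p lt_q; rewrite /= in lt_p lt_q nCov.
  case: eqP => [evw rv|/eqP nvw /andP[Evw npq]].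
    rewrite -evw in adj two *; apply: (two (v, inord 2)).
      rewrite /a /sadj /keep /unit_pair /= eqxx /link inordK // /consecutive.
      by rewrite andbF /= andbT; case: (val p) lt_p => [|[|]].
    rewrite /a /sadj /keep /unit_pair /= eqxx /link inordK // /consecutive.
    by case: (val q) lt_q => [|[|]].
  have inner u : (u \in Cov) || ~~ r u -> a (u, p) (u, q).
    move=> hu; rewrite /a /sadj /keep /unit_pair /= !eqxx lt_p lt_q /= orbC hu andbT.
    move: npq; rewrite -val_eqE /=; case: (val p) lt_p => [|[|]] //; case: (val q) lt_q => [|[|]] //.
  have outer (s : 'I_k.+3) : s < 2 -> a (v, s) (w, s).
    move=> lt_s; rewrite /a /sadj /keep /unit_pair /= (negbTE nvw) lt_s Evw /=.
    by rewrite eqxx.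
  case/or4P: (cov _ _ Evw) => hc.
  - by apply: (two (v, q)); [apply: inner; rewrite hc|apply: outer].
  - by apply: (two (v, q)); [apply: inner; rewrite hc orbT|apply: outer].
  - by apply: (two (w, p)); [apply: outer|apply: inner; rewrite hc].
  by apply: (two (w, p)); [apply: outer|apply: inner; rewrite hc orbT].
apply: le_trans (bigmin_le_cond _ _ spanH) _.
rewrite (cost_card (edge_set a)) ler_nat.
pose f v : {set svertex} := [set (v, inord 0); (v, inord 1)].
apply: leq_trans (leq_imset_card f Cov); apply/subset_leq_card/subsetP => e.
rewrite inE => /andP[/edge_setP[[v p] [[w q] [/andP[adj kyz] ->]]]].
rewrite mem_edge_set; last exact: unit_pair_sym.
move=> uyz; move: kyz; rewrite /keep uyz /= => /andP[/eqP evw Cv]; rewrite -evw in adj uyz *.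
apply/imsetP; exists v => //; move: uyz adj => /and3P[/= lt_p lt_q _].
rewrite /sadj /= eqxx /f => lpq.
rewrite -(inord_val p) -(inord_val q).
move: lpq; case: (nat_of_ord p) lt_p => [|[|]] //; case: (nat_of_ord q) lt_q => [|[|]] //.
by rewrite setUC.
Qed.

(** Consider the edge between [(v, 0)] and [(w, 1)]. If it is missing, then for lack of triangles
    its detour passes through another copy of [v] or [w], hence along a gadget edge. *)
Lemma unit_edge_of_spanner (H : {set {set svertex}}) v w :
  (forall x, E v x -> ~~ E w x) ->
  is_2spanner (G := spanner_graph) H -> E v w -> v != w -> r v -> r w ->
  exists y z, [/\ [set y; z] \in H, unit_pair y z, y.1 \in [:: v; w] & z.1 \in [:: v; w]].
Proof.
move=> notri /andP[/subsetP subH /forallP sp] Evw nvw rv rw.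
pose y0 : svertex := (v, inord 0); pose z0 : svertex := (w, inord 1).
have adj0 : sadj y0 z0 by rewrite /sadj /= (negbTE nvw) !inordK // Evw.
have uyz : unit_pair y0 z0.
  by rewrite /unit_pair /= (negbTE nvw) !inordK // Evw -val_eqE /= !inordK.
have edgeH y z : adjacent H y z -> sadj y z.
  by move=> /subH; rewrite mem_edge_set //; apply: sadj_sym.
have := forallP (sp y0) z0; rewrite (adjacent_edge_set sadj_sym) adj0 /=.
case/existsP => -[[|x [|x' [|//]]] /= _] /andP[].
- by move=> /eqP /= e; rewrite e eqxx in nvw.
- rewrite andbT => adjH /eqP ex; rewrite ex in adjH.
  by exists y0, z0; rewrite !inE !eqxx orbT; split.
case/and3P => yx xz _ /eqP ex; rewrite {x'}ex in xz.
have adj1 := edgeH _ _ yx; have adj2 := edgeH _ _ xz.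
case: x => [x p] in yx xz adj1 adj2.
have [exv|nxv] := eqVneq v x.
  subst x; move: adj2; rewrite sadj_low //= ?inordK ?orbT //.
  case/and3P => lt_p _ _; exists y0, (v, p); rewrite !inE !eqxx; split=> //.
  by rewrite /unit_pair /= eqxx inordK // lt_p.
have [exw|nxw] := eqVneq x w.
  subst x; move: adj1; rewrite sadj_low //= ?inordK //.
  case/and3P => _ lt_p _; exists (w, p), z0; rewrite !inE !eqxx !orbT; split=> //.
  by rewrite /unit_pair /= eqxx !inordK // lt_p.
move: adj1 adj2; rewrite !sadj_low //= ?inordK ?orbT //.
by move=> /and3P[_ _ Evx] /and3P[_ _]; rewrite Esym (negbTE (notri x _)).
Qed.

End OneGraph.

End SpannerGraph.

(** * Executions on a spanner instance *)

Section Touch.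
Variables (R : realFieldType) (V : finType) (k n : nat) (r : pred V).
Variables (E : rel V) (Esym : symmetric E) (A : local_algorithm R n).
Local Notation T := (svertex V k).
Local Notation G := (spanner_graph R k r Esym).
Variables (id : {ffun T -> 'I_n}) (tape : {ffun T -> seed A}).

(* [x] pays: one of its two copies outputs an edge of weight 1. *)
Definition touch (x : V) : bool :=
  [exists a : 'I_k.+3, exists z : T,
     [&& sadj E (x, a) z, unit_pair r E (x, a) z &
         output (state_after (G := G) id tape k (x, a)) (id z)]].

Lemma runP e : reflect (exists y z : T, [/\ sadj E y z, e = [set y; z] &
    output (state_after (G := G) id tape k y) (id z)])
  (e \in run (G := G) id k tape).
Proof.
apply: (iffP bigcupP) => [[y _ /imsetP[z]]|[y [z [adj -> out]]]].
  rewrite inE (adjacent_edge_set (sadj_sym Esym)) => /andP[adj out] ->.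
  by exists y, z.
exists y => //; apply/imsetP; exists z => //.
by rewrite inE (adjacent_edge_set (sadj_sym Esym)) adj.
Qed.

Lemma touchP x : reflect
  (exists y z : T, [/\ [set y; z] \in run (G := G) id k tape, unit_pair r E y z, y.1 = x &
    output (state_after (G := G) id tape k y) (id z)]) (touch x).
Proof.
apply: (iffP existsP) => [[a /existsP[z /and3P[adj u out]]]|[[x' a] [z [eyz u /= <- out]]]].
  by exists (x, a), z; split=> //; apply/runP; exists (x, a), z.
exists a; apply/existsP; exists z; rewrite u out !andbT.
case/runP: eyz => y' [z' [adj e _]].
by case: (set2_eqP e) => -[-> ->] //; rewrite (sadj_sym Esym).
Qed.

Lemma spanner_touch v w : (forall x, E v x -> ~~ E w x) ->
  is_2spanner (run (G := G) id k tape) -> E v w -> v != w -> r v -> r w ->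
  touch v || touch w.
Proof.
move=> notri sp Evw nvw rv rw.
have [y [z [yz uyz yvw zvw]]] := unit_edge_of_spanner notri sp Evw nvw rv rw.
have in_touch y' z' : y'.1 \in [:: v; w] -> unit_pair r E y' z' ->
    [set y'; z'] \in run (G := G) id k tape ->
    output (state_after (G := G) id tape k y') (id z') -> touch v || touch w.
  rewrite !inE => /orP[]/eqP ey u yz' out; apply/orP; [left|right];
  by apply/touchP; exists y', z'.
have /runP[y' [z' [_ e out]]] := yz.
case: (set2_eqP e) => -[ey ez]; subst y' z'; first exact: in_touch out.
by apply: in_touch zvw _ _ out; rewrite 1?unit_pair_sym // setUC.
Qed.

(** Different paying vertices of [C0] own different edges: a common one would join copies of two
    adjacent vertices of [C0]. *)
Lemma cost_touch (C0 : {set V}) :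
  {in C0 &, forall v w, ~~ E v w} ->
  (\sum_(x in C0) (touch x)%:R <= cost (run (G := G) id k tape))%R.
Proof.
move=> indep; rewrite cost_card -natr_sum ler_nat -big_mkcondr sum1_card.
pose good x (e : {set T}) := [exists y : T, exists z : T,
  [&& e == [set y; z], unit_pair r E y z, y.1 == x & e \in run (G := G) id k tape]].
pose f x := odflt set0 [pick e | good x e].
have fP x : touch x -> good x (f x).
  case/touchP => y [z [eyz u ex _]]; rewrite /f; case: pickP => [//|/(_ [set y; z])].
  suff -> : good x [set y; z] by [].
  by apply/existsP; exists y; apply/existsP; exists z; rewrite eqxx u ex eqxx.
rewrite -cardsE -(card_in_imset (f := f)).
  apply/subset_leq_card/subsetP => e0 /imsetP[x]; rewrite inE => /andP[_ tx] ->.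
  case/existsP: (fP _ tx) => y /existsP[z /and4P[/eqP ef u _ inrun]].
  by rewrite inE inrun ef mem_edge_set //; apply: unit_pair_sym.
move=> x x'; rewrite !inE => /andP[C0x tx] /andP[C0x' tx'] ef.
case/existsP: (fP _ tx) => y /existsP[z /and4P[/eqP e u /eqP ex _]].
case/existsP: (fP _ tx') => y' /existsP[z' /and4P[/eqP e' u' /eqP ex' _]].
rewrite -ex -ex'; rewrite ef e' in e.
case: (set2_eqP e) => -[ey ez]; first by rewrite ey.
apply/eqP; move: u; rewrite /unit_pair -ey; case: eqP => // _ /and3P[_ _ /andP[]].
by rewrite ex ex' (negbTE (indep _ _ C0x C0x')).
Qed.


End Touch.

(** * Transfer of executions along a local isomorphism *)

Section Transfer.
Variables (R : realFieldType) (V : finType) (k n : nat) (r : pred V).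
Variables (E1 E2 : rel V) (Esym1 : symmetric E1) (Esym2 : symmetric E2).
Variable A : local_algorithm R n.
Local Notation T := (svertex V k).
Local Notation G1 := (spanner_graph R k r Esym1).
Local Notation G2 := (spanner_graph R k r Esym2).
Variables (phi : {perm V}) (u : V) (near : nat -> V -> Prop).
Hypothesis near0 : near 0 u.
Hypothesis nearW : forall m m' v, m <= m' -> near m v -> near m' v.
Hypothesis nearS : forall m v x, near m v -> E1 v x -> near m.+1 x.
Hypothesis iso : forall v, near k v ->
  r v = r (phi v) /\ forall x, E1 v x = E2 (phi v) (phi x).

Definition Phi (y : T) : T := (phi y.1, y.2).
Definition PhiV (y : T) : T := ((phi^-1)%g y.1, y.2).

Lemma PhiK : cancel Phi PhiV.
Proof. by case=> v a; rewrite /PhiV /Phi /= permK. Qed.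

Lemma PhiVK : cancel PhiV Phi.
Proof. by case=> v a; rewrite /PhiV /Phi /= permKV. Qed.

Definition height (a : nat) := if a < 2 then 0 else a.-1.

(** The distance of [y] from the gadget of [u] is at most [j + height y.2]. The far copies have
    height [k.+1] and are never visible. *)
Definition visible t (y : T) := exists j, near j y.1 /\ j + height y.2 + t <= k.

Lemma visibleW t y : visible t.+1 y -> visible t y.
Proof. by move=> [j [nj le]]; exists j; split=> //; lia. Qed.

Lemma visible_near t y : visible t y -> near k y.1.
Proof. by move=> [j [nj le]]; apply: nearW nj; lia. Qed.

Lemma visible_step t y z : visible t.+1 y -> sadj E1 y z -> visible t z.
Proof.
move=> [j [nj le]]; rewrite /sadj; case: eqP => [e lk|_].
  exists j; rewrite -e; split=> //; move: lk le; rewrite /link /consecutive /height.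
  by case: ifP; case: ifP; lia.
case/orP => [/and3P[_ lt_z Eyz]|/and3P[/eqP ey _ _]].
  exists j.+1; split; first exact: nearS Eyz.
  by rewrite /height lt_z; move: le; lia.
by move: le; rewrite ey /height /=; lia.
Qed.

Lemma sadj_Phi t y z : visible t y -> sadj E1 y z = sadj E2 (Phi y) (Phi z).
Proof.
move=> vis; have [_ isoE] := iso (visible_near vis).
rewrite /sadj /= (inj_eq perm_inj); case: eqP => // _; rewrite -isoE.
case: vis => j [_ le]; have /negbTE-> : nat_of_ord y.2 != k.+2.
  by apply/eqP => ey; move: le; rewrite ey /height /=; lia.
by [].
Qed.

Lemma unit_Phi t y z : visible t y ->
  unit_pair r E1 y z = unit_pair r E2 (Phi y) (Phi z).
Proof.
move=> vis; have [isor isoE] := iso (visible_near vis).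
by rewrite /unit_pair /= (inj_eq perm_inj) isor -isoE.
Qed.

Variables (id2 : {ffun T -> 'I_n}) (tape2 : {ffun T -> seed A}).
Hypothesis id2_inj : injective id2.
Definition pull (X : finType) (f : {ffun T -> X}) : {ffun T -> X} := [ffun y => f (Phi y)].

Lemma neighbour_Phi t y i : visible t y ->
  neighbour (G := G2) id2 (Phi y) i =
  omap Phi (neighbour (G := G1) (pull id2) y i).
Proof.
move=> vis; rewrite /neighbour.
have adj1 := adjacent_edge_set (sadj_sym Esym1).
have adj2 := adjacent_edge_set (sadj_sym Esym2).
case: pickP => [z /andP[]|none]; case: pickP => [z' /andP[]|none'] //=.
- move=> _ + _; rewrite ffunE => /eqP <- /eqP/id2_inj -> //.
- rewrite adj2 -(PhiVK z) -(sadj_Phi _ vis) => adj iz.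
  by have := none' (PhiV z); rewrite adj1 adj ffunE iz.
rewrite adj1 (sadj_Phi _ vis) ffunE => adj iz.
by have := none (Phi z'); rewrite adj2 adj iz.
Qed.

Lemma neighbour_sadj (E : rel V) (Es : symmetric E) (id : {ffun T -> 'I_n}) y i z :
  neighbour (G := spanner_graph R k r Es) id y i = Some z -> sadj E y z.
Proof.
rewrite /neighbour; case: pickP => // z' /andP[adj _] [<-].
by rewrite (adjacent_edge_set (sadj_sym Es)) in adj.
Qed.

(** One more round reads the states of neighbours one round earlier, and by [visible_step] these are
    still visible. *)
Lemma state_Phi t y : visible t y ->
  state_after (G := G1) (pull id2) (pull tape2) t y =
  state_after (G := G2) id2 tape2 t (Phi y).
Proof.
elim: t y => [|t IH] y vis /=.
  rewrite !ffunE; congr init; apply: boolp.funext => i.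
  rewrite (neighbour_Phi _ vis); case: (neighbour _ _ _) => //= z.
  rewrite /sweight !mem_edge_set; try exact: unit_pair_sym.
  by rewrite (unit_Phi _ vis).
rewrite (IH _ (visibleW vis)); congr receive; apply: boolp.funext => i.
rewrite (neighbour_Phi _ vis); case en: (neighbour _ _ _) => [z|] //=.
rewrite (IH z) ?ffunE //; apply: visible_step vis _.
exact: neighbour_sadj en.
Qed.

Lemma touch_Phi :
  touch r Esym1 (pull id2) (pull tape2) u = touch r Esym2 id2 tape2 (phi u).
Proof.
rewrite /touch; apply: eq_existsb => a.
have [lt_a|le_a] := ltnP a 2; last first.
  by apply/existsP/existsP => -[z /and3P[_]]; rewrite /unit_pair /= ltnNge le_a.
have vis : visible k (u, a) by exists 0; rewrite /height lt_a.
apply/existsP/existsP => -[z]; last rewrite -{1 2 3}(PhiVK z).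
  rewrite (sadj_Phi _ vis) (unit_Phi _ vis) (state_Phi vis) ffunE => tz.
  by exists (Phi z).
move=> tz; exists (PhiV z).
by rewrite (sadj_Phi _ vis) (unit_Phi _ vis) (state_Phi vis) ffunE.
Qed.

End Transfer.

(** * Averaging over identifiers and seeds *)

Section Expectation.
Variables (R : realFieldType) (V : finType) (k n : nat) (r : pred V).
Variable A : local_algorithm R n.
Local Notation T := (svertex V k).
Local Open Scope ring_scope.

Definition seed_prob (tape : {ffun T -> seed A}) : R := \prod_y seed_dist (tape y).

Lemma seed_prob_ge0 tape : 0 <= seed_prob tape.
Proof. by apply: prodr_ge0 => y _; apply: seed_dist_ge0. Qed.

Lemma seed_prob_sum1 : \sum_tape seed_prob tape = 1.
Proof.
rewrite /seed_prob -(bigA_distr_bigA (fun _ => @seed_dist R n A)) big1 // => y _.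
exact: seed_dist_sum1.
Qed.

(** The probability that [x] pays, summed over all identifier assignments. A local isomorphism
    changes the assignment; the sum does not notice this. *)
Definition touch_mass (E : rel V) (Esym : symmetric E) (x : V) : R :=
  \sum_(id : {ffun T -> 'I_n} | injectiveb id)
    \sum_(tape : {ffun T -> seed A}) seed_prob tape * (touch r Esym id tape x)%:R.

Lemma touch_mass_transfer (E1 E2 : rel V) (Esym1 : symmetric E1) (Esym2 : symmetric E2)
    (phi : {perm V}) u (near : nat -> V -> Prop) :
  near 0%N u -> (forall m m' v, (m <= m')%N -> near m v -> near m' v) ->
  (forall m v x, near m v -> E1 v x -> near m.+1 x) ->
  (forall v, near k v -> r v = r (phi v) /\ forall x, E1 v x = E2 (phi v) (phi x)) ->
  touch_mass Esym1 u = touch_mass Esym2 (phi u).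
Proof.
move=> near0 nearW nearS iso; rewrite /touch_mass.
have pull_bij (X : finType) : bijective (@pull V k phi X).
  exists (fun f : {ffun T -> X} => [ffun y => f (PhiV phi y)] : {ffun T -> X}) => f; apply/ffunP => y; rewrite !ffunE.
    by rewrite PhiVK.
  by rewrite PhiK.
have pull_inj (X : finType) (f : {ffun T -> X}) : injectiveb (pull phi f) = injectiveb f.
  apply/injectiveP/injectiveP => finj y z.
    rewrite -(PhiVK phi y) -(PhiVK phi z) => e; congr Phi.
    by apply: finj; rewrite !ffunE.
  by rewrite !ffunE => /finj e; apply: (can_inj (PhiK phi)).
rewrite (reindex (@pull V k phi 'I_n)); last exact/onW_bij/pull_bij.
apply: eq_big => [id|id]; rewrite pull_inj // => /injectiveP id_inj.
rewrite (reindex (@pull V k phi (seed A))); last exact/onW_bij/pull_bij.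
apply: eq_bigr => tape _; congr (_ * _%:R).
  rewrite /seed_prob [RHS](reindex (Phi phi)); last first.
    by apply: onW_bij; exists (PhiV phi); [apply: PhiK|apply: PhiVK].
  by apply: eq_bigr => y _; rewrite ffunE.
congr nat_of_bool; exact: (touch_Phi _ _ near0 nearW nearS iso _ id_inj).
Qed.

Lemma touch_mass_adjacent (E : rel V) (Esym : symmetric E) v w :
  #|{: T}| = n -> solves_2spanner A k ->
  (forall x, E v x -> ~~ E w x) -> E v w -> v != w -> r v -> r w ->
  #|[pred id : {ffun T -> 'I_n} | injectiveb id]|%:R <=
    touch_mass Esym v + touch_mass Esym w.
Proof.
move=> cardT sol notri Evw nvw rv rw; rewrite -big_split /= -sum1_card natr_sum.
apply: ler_sum => id /injectiveP id_inj; rewrite -big_split /=.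
apply: (@le_trans _ _ (\sum_tape seed_prob tape)); first by rewrite seed_prob_sum1.
apply: ler_sum => tape _; rewrite -mulrDr.
(* Correctness is only guaranteed on tapes of positive probability; the others contribute 0 to both
   sides. *)
have := seed_prob_ge0 tape; rewrite le_eqVlt => /orP[/eqP<-|pos]; first by rewrite mul0r.
apply: ler_peMr; first exact: ltW.
rewrite -natrD ler1n.
have sp := sol (spanner_graph R k r Esym) id cardT id_inj tape pos.
have := spanner_touch notri sp Evw nvw rv rw.
by case: (touch _ _ _ _ v); case: (touch _ _ _ _ w).
Qed.

Lemma expected_cost_sum (E : rel V) (Esym : symmetric E) (C0 : {set V}) :
  {in C0 &, forall v w, ~~ E v w} ->
  \sum_(x in C0) touch_mass Esym x <=
  \sum_(id : {ffun T -> 'I_n} | injectiveb id)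
     expected_cost (G := spanner_graph R k r Esym) A id k.
Proof.
move=> indep; rewrite /touch_mass exchange_big /=; apply: ler_sum => id _.
rewrite exchange_big /=; apply: ler_sum => tape _.
rewrite -mulr_sumr; apply: ler_wpM2l; first exact: seed_prob_ge0.
exact: cost_touch.
Qed.

Lemma card_ids : #|{: T}| = n -> (0 < #|[pred id : {ffun T -> 'I_n} | injectiveb id]|)%N.
Proof.
move=> cardT; apply/card_gt0P.
exists [ffun y => cast_ord cardT (enum_rank y)]; rewrite inE.
by apply/injectiveP => y z; rewrite !ffunE => /cast_ord_inj/enum_rank_inj.
Qed.

(** The maximum over identifier assignments is at least the average, to which each vertex of [C0]
    contributes at least 1/2. *)
Lemma approx_ratio_lower (E : rel V) (Esym : symmetric E) (C0 : {set V}) :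
  #|{: T}| = n -> {in C0 &, forall v w, ~~ E v w} ->
  (forall x, x \in C0 -> #|[pred id : {ffun T -> 'I_n} | injectiveb id]|%:R / 2 <=
     touch_mass Esym x) ->
  0 < opt_cost (spanner_graph R k r Esym) ->
  #|C0|%:R / 2 / opt_cost (spanner_graph R k r Esym) <=
    approx_ratio A k (spanner_graph R k r Esym).
Proof.
move=> cardT indep half opt0; set N := #|_|%:R in half.
have N0 : 0 < N by rewrite ltr0n card_ids.
set rho := approx_ratio _ _ _; set opt := opt_cost _ in opt0 *.
rewrite ler_pdivrMr //.
have le_rho : N * (#|C0|%:R / 2) <= N * (rho * opt).
  have -> : N * (#|C0|%:R / 2) = \sum_(x in C0) (N / 2).
    by rewrite sumr_const -[RHS]mulr_natr mulrAC mulrA.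
  apply: le_trans (ler_sum _ half) _; apply: le_trans (expected_cost_sum Esym indep) _.
  rewrite /N -sum1_card natr_sum mulr_suml; apply: ler_sum => id inj_id.
  rewrite mul1r -ler_pdivrMr //.
  exact: (le_bigmax_cond _ (fun i => expected_cost (G := spanner_graph R k r Esym) A i k / opt) inj_id).
by rewrite -(ler_pM2l N0).
Qed.

End Expectation.

(** * The hard instances *)

Section SpannerBounds.
Variables (R : realFieldType) (V : finType) (k : nat) (r : pred V).
Variables (E : rel V) (Esym : symmetric E).
Hypothesis Eirr : irreflexive E.
Local Notation G := (spanner_graph R k r Esym).

Lemma opt_cost_ge1 v w : (forall x, E v x -> ~~ E w x) -> E v w -> r v -> r w ->
  (1 <= opt_cost G)%R.
Proof.
move=> notri Evw rv rw.
have nvw : v != w by apply/eqP => e; rewrite e Eirr in Evw.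
have ge1 (H : {set {set svertex V k}}) : is_2spanner (G := G) H -> (1 <= cost (G := G) H)%R.
  move=> spH; have [y [z [yz u _ _]]] := unit_edge_of_spanner notri spH Evw nvw rv rw.
  rewrite cost_card ler1n; apply/card_gt0P; exists [set y; z].
  by rewrite inE yz mem_edge_set //; apply: unit_pair_sym.
apply/bigmin_geP; split=> [|H]; last exact: ge1.
(* The default value of the minimum is the cost of all edges, which form a spanner too. *)
apply: ge1; apply/andP; split=> //.
apply/forallP => y; apply/forallP => z; apply/implyP => adj.
by apply/existsP; exists [bseq z]; rewrite /= adj /=.
Qed.

Lemma card_consecutive n : #|[set w : V | consecutive n (enum_rank w)]| <= 2.
Proof.
have -> : [set w : V | consecutive n (enum_rank w)] =
    [set w : V | n.+1 == enum_rank w] :|: [set w : V | (enum_rank w).+1 == n].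
  by apply/setP => w; rewrite !inE.
rewrite (leq_trans (leq_card_setU _ _).1) // -(addn1 1) leq_add //.
  apply/card_le1_eqP => v w; rewrite !inE => /eqP ev /eqP ew.
  by apply: enum_rank_inj; apply: val_inj; rewrite /= -ev -ew.
apply/card_le1_eqP => v w; rewrite !inE => /eqP ev /eqP ew.
by apply: enum_rank_inj; apply: val_inj; apply: succn_inj; rewrite ev ew.
Qed.

Lemma max_degree_le D : (forall v, #|[set w | E v w]| <= D) ->
  max_degree G <= 2 * D + k + 5.
Proof.
move=> degE; apply/bigmax_leqP => -[v a] _.
apply: (@leq_trans #|[set z : svertex V k | sadj E (v, a) z]|).
  apply: leq_trans (leq_imset_card (fun z => [set (v, a); z]) _).
  apply/subset_leq_card/subsetP => e; rewrite inE => /andP[/edge_setP[y [z [adj ->]]]].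
  rewrite !inE => /orP[]/eqP e0; rewrite -e0 in adj *.
    by apply/imsetP; exists z; rewrite ?inE.
  by apply/imsetP; exists y; rewrite ?inE 1?sadj_sym // setUC.
(* The copies of [v] itself, copies 0 and 1 of its neighbours, and the far copies of the at most two
   vertices of consecutive rank. *)
apply: (@leq_trans #|setX [set v] [set: 'I_k.+3] :|:
    setX [set w | E v w] [set inord 0; inord 1] :|:
    setX [set w | consecutive (enum_rank v) (enum_rank w)] [set (@ord_max k.+2)]|).
  apply/subset_leq_card/subsetP => -[w b]; rewrite !inE /sadj /= eq_sym.
  case: eqP => //= _ /orP[/and3P[_ lt_b ->]|/and3P[_ /eqP eb ->]].
    suff -> : (b == inord 0) || (b == inord 1) by [].
    by rewrite -!val_eqE /= !inordK //; case: (nat_of_ord b) lt_b => [|[|]].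
  suff -> : b == ord_max by rewrite orbT.
  by rewrite -val_eqE /= eb.
rewrite (leq_trans (leq_card_setU _ _).1) //.
apply: (@leq_trans (k.+3 + 2 * D + 2)); last by lia.
apply: leq_add; last first.
  by rewrite cardsX cards1 muln1 card_consecutive.
rewrite (leq_trans (leq_card_setU _ _).1) // leq_add //.
  by rewrite cardsX cards1 mul1n cardsT card_ord.
by rewrite cardsX mulnC leq_mul // cards2; case: eqP.
Qed.

Lemma max_degree_ge v : #|[set w | E v w]| <= max_degree G.
Proof.
pose y : svertex V k := (v, ord0).
pose f w : {set svertex V k} := [set y; (w, ord0)].
have finj : injective f.
  by move=> w w' /set2_eqP[[_ []] //|[[e] [e']]]; rewrite e' e.
rewrite -(card_imset _ finj).
apply: (@leq_trans #|[set e in edges G | y \in e]|); last first.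
  exact: (leq_bigmax_cond (F := fun v : vertex G => #|[set e in edges G | v \in e]|)).
apply/subset_leq_card/subsetP => e /imsetP[w + ->]; rewrite inE => Evw.
rewrite inE set21 andbT; apply/edge_setP; exists y, (w, ord0); split=> //.
rewrite sadj_low //=; by apply/eqP => evw; rewrite evw Eirr in Evw.
Qed.

End SpannerBounds.

Section HardSpanner.
Variables (R : realFieldType) (k d : nat).
Variables (F : finFieldType) (gT : finGroupType) (L : bool -> F -> gT).
Variable iota : 'I_(d ^ k) -> F.
Hypotheses (k0 : 0 < k) (d1 : 1 < d) (le_kd : k.*2 <= d).
Hypothesis Lfree : alternating_free k.+1 L.
Hypothesis iota_inj : injective iota.

Local Notation E := (node_adj L iota).
Let Esym z : symmetric (E z) := node_adj_sym L iota d1 z.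
Local Notation V := (node k d gT).
Local Notation real := (@real_node k d gT).

Definition hard_graph := spanner_graph R k real (Esym false).

Lemma node_adj_irr z : irreflexive (E z).
Proof. by move=> v; apply/idP => adj; move: (node_adj_side adj); case: v.1.1. Qed.

Lemma node_adj_triangle z v w x : E z v w -> E z v x -> ~~ E z w x.
Proof.
move=> /node_adj_side evw /node_adj_side evx; apply/negP => adj.
by move: (node_adj_side adj); rewrite evx evw; case: v.1.1.
Qed.

Lemma hard_approx_ratio (A : local_algorithm R (nvert hard_graph)) :
  solves_2spanner A k -> (d%:R / (4 * k%:R) <= approx_ratio A k hard_graph)%R.
Proof.
move=> sol; set C0 := [set v : V | root_node v].
set Cov := [set v : V | real v && ~~ root_node v].
have [x2 [adj2 val2 el2]] := matched_roots L iota d1.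
set x1 := some_root k gT d1 in adj2.
have real1 : real x1 by apply: root_real; apply: root_some_root.
have real2 : real x2.
  by apply: root_real; rewrite /root_node (node_valid_false val2) el2.
have [y /andP[adjy realy]] := real_neighbour_of_root L iota k0 d1.
have opt1 : (1 <= opt_cost hard_graph)%R.
  apply: (opt_cost_ge1 R k (Esym false) (@node_adj_irr false) _ adjy real1 realy) => x.
  exact: node_adj_triangle.
(* Of two adjacent vertices one is not a root; it lies in [Cov] or has weight 0. *)
have opt_le : (opt_cost hard_graph <= #|Cov|%:R)%R.
  apply: opt_cost_le => v w Evw; rewrite !inE.
  have := root_independent d1 Evw; case: (root_node v) => [/(_ isT) -> | _].
    by rewrite andbT; case: (real w); rewrite !orbT.
  by rewrite andbT; case: (real v).
have Cov_le : #|Cov| * d <= k.*2 * #|C0| by apply: card_real_nonroot.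
have mass (x x' : V) : root_node x -> node_valid true x' -> node_letters x' = [::] ->
    touch_mass k real A (Esym false) x = touch_mass k real A (Esym true) x'.
  move=> rx vx' ex'.
  have [phi [<- iso]] := root_local_isomorphism k0 d1 Lfree iota_inj rx vx' ex'.
  apply: (touch_mass_transfer _ _ _ (near := walk_ball (node_step L iota false) x)).
  - exact: walk_ball0.
  - by move=> m m' v; apply: walk_ballW.
  - by move=> m v w; apply: walk_ball_step; apply: node_step_inv.
  exact: iso.
(* A root of the first graph has the same mass as each of the matched roots [x1] and [x2] of the
   second, one of which always pays. *)
have half (x : V) : x \in C0 ->
    (#|[pred id : {ffun svertex V k -> 'I_(nvert hard_graph)} | injectiveb id]|%:R / 2 <=
     touch_mass k real A (Esym false) x)%R.
  rewrite inE => rx.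
  have e1 := mass x x1 rx (some_root_valid k gT d1 true) (some_root_letters k gT d1).
  have e2 := mass x x2 rx val2 el2.
  rewrite ler_pdivrMr // mulr_natr mulr2n {1}e1 e2.
  apply: touch_mass_adjacent => //; first by move=> w; apply: node_adj_triangle.
  by apply/eqP => e; move: adj2; rewrite -e node_adj_irr.
have opt0 : (0 < opt_cost hard_graph)%R by apply: lt_le_trans opt1.
have indep : {in C0 &, forall v w, ~~ E false v w}.
  move=> v w; rewrite !inE => rv rw; apply/negP => /(root_independent d1)/(_ rv).
  by rewrite rw.
apply: le_trans (approx_ratio_lower erefl indep half opt0).
(* The factor 4 combines the probability 1/2 with the factor 2 in [Cov_le]. *)
rewrite ler_pdivrMr ?mulr_gt0 ?ltr0n //.
rewrite [leRHS]mulrAC ler_pdivlMr //.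
apply: le_trans (ler_wpM2l (ler0n R d) opt_le) _.
rewrite -(ler_nat R) -mul2n !natrM in Cov_le.
by rewrite mulrC; apply: le_trans Cov_le _; lra.
Qed.

Lemma hard_max_degree_le : max_degree hard_graph <= 2 * d ^ k + k + 5.
Proof. by apply: max_degree_le => v; apply: card_node_adj. Qed.

Lemma hard_max_degree_ge : d ^ k <= max_degree hard_graph.
Proof.
apply: leq_trans (card_root_adj d1 Lfree iota_inj) _.
by apply: max_degree_ge; apply: node_adj_irr.
Qed.

Lemma hard_nvert :
  nvert hard_graph = 2 * (#|{: word k}| * (d ^ k) ^ k) * #|gT| * (k + 3).
Proof. by rewrite /nvert /hard_graph /= card_prod card_node card_ord addn3. Qed.

End HardSpanner.

(** [d] is the [k]-th root of [p] rounded down. So [d ^ k] ports embed into the field, whose size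
    exceeds [d ^ k] by at most a factor [2 ^ k]. *)
Lemma prime_root k M : 0 < k -> 0 < M ->
  exists p d, [/\ prime p, M <= d, d ^ k <= p & p <= (2 * d) ^ k].
Proof.
move=> k0 M0; have [p lt_p pr_p] := prime_above (M ^ k).
pose P d := d ^ k <= p.
have exP : exists d, P d by exists M; apply: ltnW.
have leP d : P d -> d <= p.
  by case: d => // d Pd; apply: leq_trans Pd; rewrite -{1}(expn1 d.+1) leq_pexp2l.
have [d Pd maxd] := ex_maxnP exP leP.
exists p, d; have le_Md : M <= d by apply: maxd; apply: ltnW.
split=> //; have d0 : 0 < d by apply: leq_trans le_Md.
apply: (@leq_trans (d.+1 ^ k)); last by rewrite leq_exp2r //; lia.
by rewrite ltnW // ltnNge; apply/negP => /maxd; rewrite ltnn.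
Qed.

Lemma hard_graph_exists (R : realFieldType) k : 0 < k -> exists2 C, 0 < C &
  forall N, exists (G : wgraph R) (d : nat),
  [/\ N <= nvert G, N <= max_degree G, 1 < d,
      nvert G <= C * d ^ (4 * k ^ 2) /\ max_degree G <= 4 * d ^ k &
      forall A : local_algorithm R (nvert G), solves_2spanner A k ->
        (d%:R / (4 * k%:R) <= approx_ratio A k G)%R].
Proof.
move=> k0; have word0 : 0 < #|{: word k}| by apply/card_gt0P; exists (mkword k [::]).
(* The factors stand for the sides, the words, the loss [p <= (2 * d) ^ k] in the group order, and
   the copies. *)
exists (2 * #|{: word k}| * 2 ^ (k * (2 * k).+1) * (k + 3)).
  by rewrite !muln_gt0 word0 expn_gt0 addn3.
(* A lower bound for [d] that gives [N <= d], [1 < d] and [k.*2 <= d], and absorbs the summand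
   [k + 5] of the degree. *)
move=> N; have M0 : 0 < N + 2 * k + 5 by lia.
have [p [d [pr_p le_d le_p ge_p]]] := prime_root k0 M0.
have d1 : 1 < d by lia.
have D1 : 1 < k.+1 by [].
have free := toeplitz_alternating_free 'F_p D1.
pose iota (s : 'I_(d ^ k)) : 'F_p := (s%:R)%R.
have iota_inj : injective iota.
  move=> s t /(congr1 val); rewrite /= !val_Fp_nat // !modn_small; last 2 first.
  - exact: leq_trans (ltn_ord t) le_p.
  - exact: leq_trans (ltn_ord s) le_p.
  exact: val_inj.
have le_kd : k.*2 <= d by lia.
have le_ddk : d <= d ^ k by rewrite -{1}(expn1 d) leq_exp2l.
pose G := hard_graph R (toeplitz_letter_of D1) iota d1.
have card_gT := card_toeplitz 'F_p D1; rewrite card_Fp // in card_gT.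
have gT0 : 0 < #|{: subg_of (toeplitz_group 'F_p D1)}|.
  by apply/card_gt0P; exists 1%g.
have nvertE := hard_nvert R (toeplitz_letter_of D1) iota d1.
have deg_le := hard_max_degree_le R (toeplitz_letter_of D1) iota d1.
have deg_ge := hard_max_degree_ge R d1 free iota_inj.
exists G, d; split=> //.
- rewrite nvertE; apply: (@leq_trans d); first by lia.
  apply: (leq_trans le_ddk).
  have le1 : d ^ k <= (d ^ k) ^ k by rewrite -{1}(expn1 (d ^ k)) leq_pexp2l // expn_gt0; lia.
  apply: (leq_trans le1).
  have rot w x g y : 2 * (w * x) * g * y = 2 * w * g * y * x by lia.
  by rewrite rot leq_pmull // !muln_gt0 word0 gT0 addn3.
- by apply: leq_trans deg_ge; lia.
- split; last by apply: leq_trans deg_le _; lia.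
  rewrite nvertE.
  apply: (@leq_trans (2 * (#|{: word k}| * (d ^ k) ^ k) * p ^ (k.+1 + k) * (k + 3))).
    by rewrite leq_mul2r leq_mul2l card_gT !orbT.
  apply: (@leq_trans (2 * (#|{: word k}| * (d ^ k) ^ k) * ((2 * d) ^ k) ^ (k.+1 + k) * (k + 3))).
    by rewrite leq_mul2r leq_mul2l leq_exp2r ?ge_p ?orbT // addSn.
  rewrite -!expnM expnMn.
  have -> : k * (k.+1 + k) = k * (2 * k).+1 by lia.
  set a := 2 ^ _; set b := d ^ (k * _.+1).
  have -> : 2 * (#|{: word k}| * d ^ (k * k)) * (a * b) * (k + 3) =
            2 * #|{: word k}| * a * (k + 3) * (d ^ (k * k) * b) by lia.
  (* The indices contribute the exponent [k ^ 2] and the group [k * (2 * k + 1)]; the sum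
     [3 * k ^ 2 + k] is at most [4 * k ^ 2]. *)
  rewrite leq_mul2l -expnD leq_exp2l //; apply/orP; right; nia.
exact: hard_approx_ratio.
Qed.

(** * Asymptotics *)

From mathcomp Require Import all_classical all_reals all_analysis.
Import numFieldNormedType.Exports.
Local Open Scope ring_scope.
Local Open Scope classical_set_scope.

Lemma cvg_inv_ln (R : realType) (a : R) : a / ln n%:R @[n --> \oo] --> (0 : R).
Proof.
apply/cvgr0Pnorm_le => e e0; near=> n.
have n1 : expR 1 <= n%:R :> R by near: n; exact: nbhs_infty_ger.
have na : expR (`|a| / e) <= n%:R :> R by near: n; exact: nbhs_infty_ger.
have n0 : 0 < n%:R :> R by apply: lt_le_trans n1; exact: expR_gt0.
have ln1 : 1 <= ln (n%:R : R) by rewrite -ler_expR lnK.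
have lna : `|a| / e <= ln (n%:R : R) by rewrite -ler_expR lnK.
have ln0 : 0 < ln (n%:R : R) by apply: lt_le_trans ln1.
by rewrite normrM normfV (gtr0_norm ln0) ler_pdivrMr // mulrC -ler_pdivrMr.
Unshelve. all: by end_near. Qed.

(** The exponent is chosen so that [n] to the power [ln C / ln n] is [C]; the claim is then the
    [m]-th root of [n / C <= d ^ m]. *)
Lemma root_nvert_le (R : realType) (C d n m : nat) : (0 < C)%N -> (0 < d)%N -> (1 < n)%N ->
  (0 < m)%N -> (n <= C * d ^ m)%N ->
  (n%:R : R) `^ ((1 - ln C%:R / ln n%:R) / m%:R) <= d%:R.
Proof.
move=> C0 d0 n1 m0 le_n.
have ln0 : 0 < ln (n%:R : R) by rewrite ln_gt0 ?ltr1n.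
have nn : (n%:R : R) \is Num.pos by rewrite posrE ltr0n ltnW.
have mR : 0 < m%:R :> R by rewrite ltr0n.
have dp : (d%:R : R) \is Num.pos by rewrite posrE ltr0n.
rewrite /powR pnatr_eq0 eqn0Ngt (ltnW n1) /= -[leRHS]lnK // ler_expR.
rewrite mulrAC ler_pdivrMr // mulrBl mul1r divfK ?gt_eqF // lerBlDr.
rewrite mulr_natr -lnXn ?ltr0n // -lnM ?posrE ?exprn_gt0 ?ltr0n //.
rewrite ler_ln ?posrE ?mulr_gt0 ?exprn_gt0 ?ltr0n ?(ltnW n1) //.
by rewrite -natrX -natrM ler_nat mulnC.
Qed.

(** [4 * d ^ k] is at most [(4 * d) ^ k.+1], whose root of order [k.+1] is [4 * d]. *)
Lemma root_degree_le (R : realType) (d k D : nat) : (0 < d)%N -> (D <= 4 * d ^ k)%N ->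
  (D%:R : R) `^ (1 / (k%:R + 1)) <= 4 * d%:R.
Proof.
move=> d0 le_D; have k1 : 0 < k%:R + 1 :> R by rewrite ltr_wpDl.
have le_D' : D%:R <= (4 * d%:R : R) ^+ k.+1.
  rewrite -[4]/(4%:R) -natrM -natrX ler_nat (leq_trans le_D) // expnMn leq_mul //.
    by rewrite -{1}(expn1 4) leq_pexp2l.
  by rewrite leq_pexp2l.
apply: (@le_trans _ _ (((4 * d%:R : R) ^+ k.+1) `^ (1 / (k%:R + 1)))).
  by apply: ge0_ler_powR => //; rewrite ?nnegrE ?exprn_ge0 ?mulr_ge0 // divr_ge0 // ltW.
rewrite -powR_mulrn ?mulr_ge0 // -powRrM natr1 mul1r divff ?gt_eqF ?ltr0n //.
by rewrite powRr1 ?mulr_ge0.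
Qed.

Theorem theorem17 (R : realType) :
  exists2 c : R, 0 < c &
  forall k : nat, (0 < k)%N ->
  exists2 eps : nat -> R, eps n @[n --> \oo] --> (0 : R) &
  forall N : nat, exists G : wgraph R,
    [/\ (N <= nvert G)%N, (N <= max_degree G)%N &
     forall A : local_algorithm R (nvert G), solves_2spanner A k ->
       c * ((nvert G)%:R `^ ((1 - eps (nvert G)) / (4 * k%:R ^+ 2)) / k%:R)
         <= approx_ratio A k G /\
       c * ((max_degree G)%:R `^ (1 / (k%:R + 1)) / k%:R)
         <= approx_ratio A k G].
Proof.
(* Both powers are at most [4 * d], and the ratio is at least [d / (4 * k)]. *)
exists (1 / 16); first by lra.
move=> k k0; have [C C0 hard] := hard_graph_exists R k0.
exists (fun n => ln C%:R / ln n%:R); first exact: cvg_inv_ln.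
(* The additional 2 ensures [1 < nvert G], so that [ln] of it is positive. *)
move=> N; have [G [d [le_n le_D d1 [n_le D_le] lower]]] := hard (N + 2)%N.
exists G; split; [lia|lia|] => A /lower lower_A.
have k0R : 0 < k%:R :> R by rewrite ltr0n.
have key x : x <= 4 * d%:R -> 1 / 16 * (x / k%:R) <= approx_ratio A k G.
  move=> le_x; apply: le_trans lower_A.
  have -> : d%:R / (4 * k%:R) = 1 / 16 * (4 * d%:R / k%:R) :> R by field; lra.
  by rewrite ler_pM2l ?ler_pM2r ?invr_gt0 //; lra.
have d0 : (0 < d)%N by apply: ltnW.
split; apply: key; last exact: root_degree_le.
have -> : 4 * k%:R ^+ 2 = (4 * k ^ 2)%:R :> R by rewrite natrM natrX.
apply: (@le_trans _ _ d%:R); last by rewrite ler_peMl ?ler0n ?ler1n.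
by apply: root_nvert_le n_le => //; rewrite ?muln_gt0 ?expn_gt0 ?k0 //; lia.
Qed.
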